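(* For a number field $F$ and a modulus $\mathfrak m$ of $F$, let $F^{\mathfrak m}$ be the ray class field of $F$ of modulus $\mathfrak m$, and let $S$ be the support of $\mathfrak m$ along with the set of all archimedean places of $F$. Then there exists a surjective map (group homomorphism) $$\operatorname{Gal}(F^{\mathfrak m}/F)\twoheadrightarrow H^1(\operatorname{Gal}(F^{\mathfrak m}/F),U_{F^{\mathfrak m},S}).$$
   Context: The letter $S$ also denotes the set of primes of $F^{\mathfrak m}$ lying above the primes in $S$, and $U_{F^{\mathfrak m},S}$ is the group of $S$-units of $F^{\mathfrak m}$. The ray class group of $F$ for $\mathfrak m$ is $\operatorname{Cl}(F)_{\mathfrak m}=I(F)_{\mathfrak m}/P(F)_{\mathfrak m}$, where $I(F)_{\mathfrak m}$ is the group of fractional ideals of $F$ not involving the primes dividing $\mathfrak m$ and $P(F)_{\mathfrak m}$ is the subgroup generated by the principal ideals $(a)$ with $a\in\mathcal O_F$ totally positive and $a\equiv 1 \pmod{\mathfrak m}$ (here $\mathfrak m$ is a nonzero integral ideal of $F$, the condition at the real places being built into total positivity). The ray class field $F^{\mathfrak m}$ is the abelian extension of $F$ corresponding to this group by class field theory, so that the Artin map induces $\operatorname{Gal}(F^{\mathfrak m}/F)\simeq\operatorname{Cl}(F)_{\mathfrak m}$. *)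

(* Defs.v *)
From HB Require Import structures.
From mathcomp Require Import all_boot all_order all_algebra all_fingroup all_field.
From mathcomp Require Import ring_quotient.
From mathcomp Require Import mathcomp_extra boolp classical_sets functions cardinality.

Set Implicit Arguments.
Unset Strict Implicit.
Unset Printing Implicit Defensive.

Import GRing.Theory Num.Theory.
Local Open Scope classical_set_scope.
Local Open Scope ring_scope.

Section Ideals.
Variable K : fieldType.
Implicit Types (I J C P : set K) (G T : set (set K)) (x y : K).

Definition ringint : set K := [set x | integralOver (intr : int -> K) x].

Definition integral_ideal I : Prop :=
  [/\ I `<=` ringint, I 0,
      forall x y, I x -> I y -> I (x + y),
      forall a x, ringint a -> I x -> I (a * x)
    & exists2 x, I x & x != 0].

Definition prime_ideal P : Prop :=
  [/\ integral_ideal P, ~ P 1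
    & forall a b, ringint a -> ringint b -> P (a * b) -> P a \/ P b].

Definition principal x : set K := [set a * x | a in ringint].

Definition idmul I J : set K :=
  [set x | exists n (a b : 'I_n -> K),
     [/\ forall i, I (a i), forall i, J (b i) & x = \sum_(i < n) a i * b i]].

Definition idinv I : set K := [set x | forall y, I y -> ringint (x * y)].

Definition iddvd I J : Prop := exists2 C, integral_ideal C & J = idmul I C.

(* The subgroup generated by [G] in the group of fractional ideals. *)
Inductive idgen G : set (set K) :=
| idgen_one : idgen G ringint
| idgen_in I : G I -> idgen G I
| idgen_mul I J : idgen G I -> idgen G J -> idgen G (idmul I J)
| idgen_inv I : idgen G I -> idgen G (idinv I).

Definition residues P : set (set K) :=
  [set [set y | P (y - x)] | x in ringint].

Lemma ringint1 : ringint 1.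
Proof. exact: integral1. Qed.

Lemma ringint0 : ringint 0.
Proof. exact: integral0. Qed.

Lemma principal1 : principal 1 = ringint.
Proof.
apply/seteqP; split=> x /=; first by case=> a Oa <-; rewrite mulr1.
by move=> Ox; exists x => //; rewrite mulr1.
Qed.

Lemma principalM x y : principal (x * y) = idmul (principal x) (principal y).
Proof.
apply/seteqP; split=> z /=.
  case=> a Oa <-; exists 1%N, (fun=> a * x), (fun=> 1 * y); split=> // [i|i|].
  - by exists a.
  - by exists 1 => //; apply: ringint1.
  - by rewrite big_ord1 mul1r mulrA.
case=> n [a] [b] [Ha Hb ->].
elim/big_ind: _ => [|u v [c Oc <-] [d Od <-]|i _].
- by exists 0; [apply: ringint0 | rewrite mul0r].
- by exists (c + d); [apply: integral_add | rewrite mulrDl].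
- have [[c Oc <-] [d Od <-]] := (Ha i, Hb i).
  by exists (c * d); [apply: integral_mul | rewrite mulrACA].
Qed.

Lemma principalV x : x != 0 -> principal x^-1 = idinv (principal x).
Proof.
move=> x0; apply/seteqP; split=> z /=.
  case=> a Oa <- _ [b Ob <-]; rewrite mulrACA mulVf // mulr1.
  exact: integral_mul.
move=> /(_ x) Hz; exists (z * x); last by rewrite mulfK.
by apply: Hz; exists 1; rewrite ?mul1r //; apply: ringint1.
Qed.

(* [x] is a [T]-unit when the principal ideal [(x)] is a product of positive
   and negative powers of primes in [T].  [T] holds only the nonarchimedean
   places of the set of places; the archimedean ones impose no condition. *)
Definition sunit_pred T : {pred K} :=
  [pred x | (x != 0) && `[< idgen T (principal x) >]].

Record sUnit T := SUnit { sunit_val : K; _ : sunit_val \in sunit_pred T }.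

HB.instance Definition _ T := [isSub for @sunit_val T].
HB.instance Definition _ T := [Choice of sUnit T by <:].

Lemma sunitP T (u : sUnit T) : val u != 0 /\ idgen T (principal (val u)).
Proof. by case: u => x /= /andP[? /asboolP]. Qed.

Fact sunit1_subproof T : 1 \in sunit_pred T.
Proof.
rewrite inE /= oner_eq0 /=; apply/asboolP.
by rewrite principal1; apply: idgen_one.
Qed.

Fact sunitM_subproof T (u v : sUnit T) : val u * val v \in sunit_pred T.
Proof.
have [[u0 Hu] [v0 Hv]] := (sunitP u, sunitP v).
rewrite inE /= mulf_neq0 //=; apply/asboolP.
by rewrite principalM; apply: idgen_mul.
Qed.

Fact sunitV_subproof T (u : sUnit T) : (val u)^-1 \in sunit_pred T.
Proof.
have [u0 Hu] := sunitP u.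
rewrite inE /= invr_eq0 u0 /=; apply/asboolP.
by rewrite principalV //; apply: idgen_inv.
Qed.

Definition sunit_one T : sUnit T := SUnit (sunit1_subproof T).
Definition sunit_mul T (u v : sUnit T) : sUnit T := SUnit (sunitM_subproof u v).
Definition sunit_inv T (u : sUnit T) : sUnit T := SUnit (sunitV_subproof u).

Fact sunit_mulA T : associative (@sunit_mul T).
Proof. by move=> u v w; apply: val_inj; rewrite /= mulrA. Qed.

Fact sunit_mulC T : commutative (@sunit_mul T).
Proof. by move=> u v; apply: val_inj; rewrite /= mulrC. Qed.

Fact sunit_mul1 T : left_id (sunit_one T) (@sunit_mul T).
Proof. by move=> u; apply: val_inj; rewrite /= mul1r. Qed.

Fact sunit_mulV T : left_inverse (sunit_one T) (@sunit_inv T) (@sunit_mul T).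
Proof.
by move=> u; apply: val_inj; rewrite /= mulVf //; have [] := sunitP u.
Qed.

(* The multiplicative group of [T]-units, written additively: 0 is the unit 1,
   u + v is the product of u and v, and - u is the inverse of u. *)
HB.instance Definition _ T := GRing.isZmodule.Build (sUnit T)
  (@sunit_mulA T) (@sunit_mulC T) (@sunit_mul1 T) (@sunit_mulV T).

End Ideals.

Arguments ringint {K}.

Record gmodule (gT : finGroupType) (M : zmodType) := GModule {
  gmodule_act :> {action gT &-> M};
  gmodule_actD : forall g, {morph gmodule_act^~ g : x y / x + y}
}.

Section H1.
Variables (gT : finGroupType) (M : zmodType) (to : gmodule gT M).

Lemma gmodule_act0 g : to 0 g = 0.
Proof. by apply: (addrI (to 0 g)); rewrite -gmodule_actD !addr0. Qed.

Lemma gmodule_actB g x y : to (x - y) g = to x g - to y g.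
Proof.
by apply: (addIr (to y g)); rewrite -gmodule_actD !subrK.
Qed.

(* Actions are on the right in MathComp, whence the form of the cocycle
   condition: with [g h] the composite "g, then h", this is the usual
   c(h o g) = c(h) + h . c(g). *)
Definition cocycle : {pred {ffun gT -> M}} :=
  [pred c : {ffun gT -> M} | `[< forall g h, c (g * h)%g = to (c g) h + c h >]].

Fact cocycle_zmod_closed : zmod_closed cocycle.
Proof.
split=> [|c d]; first by apply/asboolP=> g h; rewrite !ffunE gmodule_act0 addr0.
move=> /asboolP Hc /asboolP Hd; apply/asboolP=> g h.
by rewrite !ffunE Hc Hd gmodule_actB opprD addrACA.
Qed.

HB.instance Definition _ := GRing.isZmodClosed.Build _ cocycle cocycle_zmod_closed.

Record Z1 := CocycleZ1 { cochain_of :> {ffun gT -> M}; _ : cochain_of \in cocycle }.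

HB.instance Definition _ := [isSub for cochain_of].
HB.instance Definition _ := [Choice of Z1 by <:].
HB.instance Definition _ := [SubChoice_isSubZmodule of Z1 by <:].

Definition B1 : {pred Z1} :=
  [pred c : Z1 | `[< exists x : M, forall g, c g = to x g - x >]].

Fact B1_zmod_closed : zmod_closed B1.
Proof.
split=> [|c d].
  by apply/asboolP; exists 0 => g; rewrite ffunE gmodule_act0 subrr.
move=> /asboolP[x Hx] /asboolP[y Hy]; apply/asboolP; exists (x - y) => g.
by rewrite !ffunE Hx Hy gmodule_actB opprD addrACA -opprD.
Qed.

HB.instance Definition _ := GRing.isZmodClosed.Build _ B1 B1_zmod_closed.

Definition H1 : zmodType := Quotient.quot B1.

End H1.

Section RayClassField.
Variables (F : fieldExtType rat) (L : splittingFieldType F) (m : set F).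
Implicit Types (p : set F) (P : set L) (s : gal_of {:L}).

Definition modulus_support : set (set F) := [set p | prime_ideal p /\ iddvd p m].

Definition ray_ideals : set (set F) :=
  idgen [set p | prime_ideal p /\ ~ iddvd p m].

(* A real embedding is a field embedding into the algebraic complex numbers
   with real values; since [F] is algebraic over Q, all embeddings of [F] into
   C are of this form. *)
Definition totally_positive (a : F) : Prop :=
  forall phi : {rmorphism F -> algC},
    (forall x, phi x \is Num.real) -> 0 < phi a.

(* Total positivity does not exclude a = 0 when [F] has no real embedding. *)
Definition ray_principal : set (set F) :=
  idgen [set I | exists a : F,
    [/\ a != 0, ringint a, totally_positive a, m (a - 1) & I = principal a]].

Definition contracted_ideal P : set F := [set x | P x%:A].

Definition lies_above P p : Prop := prime_ideal P /\ contracted_ideal P = p.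

Definition extended_ideal p : set L := idmul [set x%:A | x in p] ringint.

Definition unramified p : Prop :=
  forall P, lies_above P p -> ~ iddvd (idmul P P) (extended_ideal p).

Definition frobenius P p s : Prop :=
  exists2 q : nat, (residues p #= `I_q)%card
    & forall x, ringint x -> P (s x - x ^+ q).

Definition artin_map (psi : set F -> gal_of {:L}) : Prop :=
  (forall I J, ray_ideals I -> ray_ideals J ->
     psi (idmul I J) = (psi I * psi J)%g) /\
  (forall p P, prime_ideal p -> ~ iddvd p m -> lies_above P p ->
     frobenius P p (psi p)).

Definition ray_class_field : Prop :=
  [/\ galois 1 {:L}, abelian 'Gal({:L} / 1),
      forall p, prime_ideal p -> ~ iddvd p m -> unramified p
    & exists psi, [/\ artin_map psi,
        forall s, s \in 'Gal({:L} / 1)%g -> exists2 I, ray_ideals I & psi I = s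
      & forall I, ray_ideals I -> (psi I = 1%g <-> ray_principal I)]].

End RayClassField.

Section GaloisSUnits.
Variables (F : fieldExtType rat) (L : splittingFieldType F) (S : set (set F)).
Implicit Types (P : set L) (s t : gal_of {:L}).

Definition primes_above : set (set L) :=
  [set P | exists2 p, S p & lies_above P p].

Local Notation U := (sUnit primes_above).

Lemma galVK s : cancel s (s^-1)%g.
Proof. by move=> x; rewrite -galM ?memvf // mulgV gal_id. Qed.

Lemma galKV s : cancel (s^-1)%g s.
Proof. by move=> x; rewrite -galM ?memvf // mulVg gal_id. Qed.

Lemma ringint_gal s x : ringint x -> ringint (s x).
Proof.
case=> p mp rp; exists p => //.
have -> : map_poly (intr : int -> L) p = map_poly s (map_poly intr p).
  by rewrite -map_poly_comp; apply: eq_map_poly => z /=; rewrite rmorph_int.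
by rewrite fmorph_root.
Qed.

Lemma image_galE s (A : set L) x : (s @` A) x <-> A ((s^-1)%g x).
Proof.
split=> [[y Ay <-]|Ax]; first by rewrite galVK.
by exists ((s^-1)%g x); rewrite ?galKV.
Qed.

Lemma image_gal_ringint s : s @` ringint = ringint :> set L.
Proof.
apply/seteqP; split=> x; first by case=> y Oy <-; apply: ringint_gal.
by move=> Ox; apply/image_galE; apply: ringint_gal.
Qed.

Lemma image_gal_idmul s I J : s @` idmul I J = idmul (s @` I) (s @` J).
Proof.
apply/seteqP; split=> x.
  case=> _ [n [a [b [Ha Hb ->]]]] <-; exists n, (s \o a), (s \o b).
  split=> [i|i|]; [by exists (a i)|by exists (b i)|].
  by rewrite rmorph_sum; apply: eq_bigr => i _; rewrite rmorphM.
case=> n [a [b [Ha Hb ->]]]; apply/image_galE.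
exists n, ((s^-1)%g \o a), ((s^-1)%g \o b); split=> [i|i|].
- exact/image_galE.
- exact/image_galE.
- by rewrite rmorph_sum; apply: eq_bigr => i _; rewrite rmorphM.
Qed.

Lemma image_gal_idinv s I : s @` idinv I = idinv (s @` I).
Proof.
apply/seteqP; split=> x.
  by case=> y Hy <- _ [z Iz <-]; rewrite -rmorphM; apply/ringint_gal/Hy.
move=> Hx; apply/image_galE => y Iy; rewrite -[y](galVK s) -rmorphM.
by apply/ringint_gal/Hx; exists y.
Qed.

Lemma image_gal_principal s x : s @` principal x = principal (s x).
Proof.
apply/seteqP; split=> y.
  by case=> _ [a Oa <-] <-; rewrite rmorphM; exists (s a) => //; apply: ringint_gal.
case=> a Oa <-; exists ((s^-1)%g a * x); last by rewrite rmorphM /= galKV.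
by exists ((s^-1)%g a) => //; apply: ringint_gal.
Qed.

Lemma image_gal_prime s P : prime_ideal P -> prime_ideal (s @` P).
Proof.
have Os := @ringint_gal (s^-1)%g.
case=> [[PO P0 PD PM [x Px x0]] P1 Pp]; split; first split.
- by move=> _ [z Pz <-]; apply/ringint_gal/PO.
- by apply/image_galE; rewrite rmorph0.
- by move=> u v /image_galE Pu /image_galE Pv; apply/image_galE; rewrite rmorphD; apply: PD.
- move=> u v Ou /image_galE Pv; apply/image_galE; rewrite rmorphM.
  by apply: PM => //; apply: Os.
- by exists (s x); [exists x | rewrite fmorph_eq0].
- by move=> /image_galE; rewrite rmorph1.
- move=> u v Ou Ov /image_galE; rewrite rmorphM => /Pp.
  by case; [apply: Os|apply: Os|left; apply/image_galE|right; apply/image_galE].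
Qed.

Lemma primes_above_gal s P : primes_above P -> primes_above (s @` P).
Proof.
case=> p Sp [PP cP]; exists p => //; split; first exact: image_gal_prime.
rewrite -cP; apply/seteqP.
have E x : (s^-1)%g (x%:A : L) = x%:A by rewrite linearZ /= rmorph1.
by split=> x; rewrite /contracted_ideal /= => H; move: H => /image_galE || apply/image_galE;
   rewrite E.
Qed.

Lemma idgen_gal s I : idgen primes_above I -> idgen primes_above (s @` I).
Proof.
elim=> {I} [|I HI|I J _ HI _ HJ|I _ HI].
- by rewrite image_gal_ringint; apply: idgen_one.
- exact/idgen_in/primes_above_gal.
- by rewrite image_gal_idmul; apply: idgen_mul.
- by rewrite image_gal_idinv; apply: idgen_inv.
Qed.

Fact sunit_gal_subproof (u : U) s : s (val u) \in sunit_pred primes_above.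
Proof.
have [u0 Hu] := sunitP u; rewrite inE /= fmorph_eq0 u0 /=; apply/asboolP.
by rewrite -image_gal_principal; apply: idgen_gal.
Qed.

Definition sunit_gal (u : U) s : U := SUnit (sunit_gal_subproof u s).

Fact sunit_gal1 : sunit_gal^~ 1%g =1 id.
Proof. by move=> u; apply: val_inj; rewrite /= gal_id. Qed.

Fact sunit_galM u : act_morph sunit_gal u.
Proof. by move=> s t; apply: val_inj; rewrite /= galM ?memvf. Qed.

Fact sunit_galD s :
  {morph (TotalAction sunit_gal1 sunit_galM)^~ s : u v / u + v}.
Proof. by move=> u v; apply: val_inj; rewrite /= rmorphM. Qed.

Definition sunit_gmodule : gmodule (gal_of {:L}) U := GModule sunit_galD.

End GaloisSUnits.

(* Main.v *)
Require Import Defs.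
From HB Require Import structures.
From mathcomp Require Import all_boot all_order all_algebra all_fingroup all_field.
From mathcomp Require Import all_solvable.
From mathcomp Require Import ring_quotient.
From mathcomp Require Import mathcomp_extra boolp classical_sets functions cardinality.

Set Implicit Arguments.
Unset Strict Implicit.
Unset Printing Implicit Defensive.

Import GRing.Theory Num.Theory.
Local Open Scope ring_scope.

(** Let [G] be the Galois group of [L / F], [S] the set of primes that divide [m], and
    [T] the set of primes of [L] above [S].

    By Hilbert 90 ([hilbert90]) a cocycle with values in the [T]-units has the form
    [s |-> s x / x] with [x] in [L]; up to a rational integer, which changes nothing,
    [x] is an algebraic integer ([ringint_scale]).  Then the ideal [(x)] is invariant
    under [G] up to products of primes in [T].  As [L / F] is unramified outside [S]
    and [G] permutes transitively the primes above a prime of [F], such an ideal has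
    the form [a O_L t] with [a] an ideal of [F] prime to [m] and [t] a product of powers
    of primes in [T] ([invariant_ideal_descent]).

    Conversely [a] determines the class of the cocycle: if [(x) = a O_L t] and
    [(y) = b O_L u], where [a] and [b] have the same image in [G] under the
    reciprocity map, then [a = b (w)] with [w] in [F], so that [x / (y w)] is a [T]-unit
    and the cocycles of [x] and of [y] are cohomologous ([capitulation_fun]).  Hence
    the image of [a] in [G] determines the class, and [H1] is a quotient of the
    subgroup of [G] formed by the images of the ideals [a] that arise in this way.

    Finally [G] is a finite abelian group, and every subgroup of such a group is
    isomorphic to a quotient of it, by duality ([abelian_onto_subquotient]); composing
    gives a surjection from [G] to [H1].

    The ideal theory behind this is developed for any field of characteristic zero
    in which [d + 1] elements are always linearly dependent over the integers.  This
    forces the rings [O / nO] to be finite ([residues_finite]), whence induction on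
    ideals ([ideal_ind]), maximality of primes, invertibility of primes and
    factorization ([prime_factor_ind]). *)

(** * Arithmetic of ideals *)

Section IdealArithmetic.
Variable K : fieldType.
Implicit Types (I J A B C P Q : set K) (x y z : K).
Local Open Scope classical_set_scope.

Lemma ringintN x : ringint x -> ringint (- x).
Proof. exact: integral_opp. Qed.

Lemma ringintD x y : ringint x -> ringint y -> ringint (x + y).
Proof. exact: integral_add. Qed.

Lemma ringintB x y : ringint x -> ringint y -> ringint (x - y).
Proof. exact: integral_sub. Qed.

Lemma ringintM x y : ringint x -> ringint y -> ringint (x * y).
Proof. exact: integral_mul. Qed.

Lemma ringint_nat n : ringint (n%:R : K).
Proof. exact: integral_nat. Qed.

Lemma ringint_int (n : int) : ringint (n%:~R : K).
Proof. exact: integral_id. Qed.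

Lemma ringintX x n : ringint x -> ringint (x ^+ n).
Proof.
by move=> Ox; elim: n => [|n IH]; rewrite ?exprS; [apply: ringint1 | apply: ringintM].
Qed.

Lemma ringint_sum (T : Type) (r : seq T) (f : T -> K) :
  (forall i, ringint (f i)) -> ringint (\sum_(i <- r) f i).
Proof.
move=> Of; elim/big_ind: _ => // [|x y]; [exact: ringint0|exact: ringintD].
Qed.

Definition ringint_module I : Prop :=
  [/\ I 0, forall x y, I x -> I y -> I (x + y) & forall a x, ringint a -> I x -> I (a * x)].

Definition invertible I : Prop := ringint_module I /\ idmul I (idinv I) = ringint.

Lemma integral_module I : integral_ideal I -> ringint_module I.
Proof. by case. Qed.

Lemma ringint_is_module : ringint_module (ringint : set K).
Proof. by split; [exact: ringint0|exact: ringintD|exact: ringintM]. Qed.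

Lemma integral_ringint : integral_ideal (ringint : set K).
Proof.
have [? ? ?] := ringint_is_module; split=> //.
by exists 1; [exact: ringint1|exact: oner_neq0].
Qed.

Lemma moduleN I x : ringint_module I -> I x -> I (- x).
Proof. by case=> _ _ IM Ix; rewrite -mulN1r; apply: IM => //; apply/ringintN/ringint1. Qed.

Lemma moduleB I x y : ringint_module I -> I x -> I y -> I (x - y).
Proof. by move=> mI Ix Iy; have [_ ID _] := mI; apply/ID => //; apply: moduleN. Qed.

Lemma mem_idmul I J x y : I x -> J y -> idmul I J (x * y).
Proof. by exists 1%N, (fun=> x), (fun=> y); split=> //; rewrite big_ord1. Qed.

Lemma idmul_sub I J C : C 0 -> (forall x y, C x -> C y -> C (x + y)) ->
  (forall x y, I x -> J y -> C (x * y)) -> idmul I J `<=` C.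
Proof.
move=> C0 CD CM z [n [a [b [Ia Jb ->]]]].
by elim/big_ind: _ => // i _; apply: CM.
Qed.

Lemma idmul_sub_module I J C : ringint_module C ->
  (forall x y, I x -> J y -> C (x * y)) -> idmul I J `<=` C.
Proof. by case=> *; apply: idmul_sub. Qed.

Lemma idmul0 I J : idmul I J 0.
Proof. by exists 0%N, (fun=> 0), (fun=> 0); split=> [[]|[]|] //; rewrite big_ord0. Qed.

Lemma idmulD I J x y : idmul I J x -> idmul I J y -> idmul I J (x + y).
Proof.
case=> n [a [b [Ia Jb ->]]] [k [c [d [Ic Jd ->]]]].
exists (n + k)%N,
  (fun i : 'I_(n + k) => match fintype.split i with inl i => a i | inr i => c i end),
  (fun i : 'I_(n + k) => match fintype.split i with inl i => b i | inr i => d i end); split.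
- by move=> i; case: (fintype.split i).
- by move=> i; case: (fintype.split i).
rewrite big_split_ord /=; congr (_ + _); apply: eq_bigr => i _.
  by rewrite (unsplitK (inl i)).
by rewrite (unsplitK (inr i)).
Qed.

Lemma idmulC I J : idmul I J = idmul J I.
Proof.
by apply/seteqP; split; apply: idmul_sub => *; rewrite 1?mulrC;
  [exact: idmul0|exact: idmulD|exact: mem_idmul
  |exact: idmul0|exact: idmulD|exact: mem_idmul].
Qed.

Lemma idmulA I J A : idmul I (idmul J A) = idmul (idmul I J) A.
Proof.
apply/seteqP; split.
  apply: idmul_sub => [||x y Ix]; [exact: idmul0|exact: idmulD|].
  case=> n [a [b [Ja Ab ->]]]; rewrite mulr_sumr.
  elim/big_ind: _ => [||i _]; [exact: idmul0|exact: idmulD|].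
  by rewrite mulrA; apply: mem_idmul => //; apply: mem_idmul.
apply: idmul_sub => [||x y]; [exact: idmul0|exact: idmulD|].
case=> n [a [b [Ja Ab ->]]] Ay; rewrite mulr_suml.
elim/big_ind: _ => [||i _]; [exact: idmul0|exact: idmulD|].
by rewrite -mulrA; apply: mem_idmul => //; apply: mem_idmul.
Qed.

Lemma idmulCA I J A : idmul I (idmul J A) = idmul J (idmul I A).
Proof. by rewrite !idmulA (idmulC I). Qed.

Lemma idmulACA I J A B :
  idmul (idmul I J) (idmul A B) = idmul (idmul I A) (idmul J B).
Proof. by rewrite -!idmulA; congr idmul; rewrite !idmulA (idmulC J). Qed.

Lemma idmulS I J A B : I `<=` A -> J `<=` B -> idmul I J `<=` idmul A B.
Proof.
move=> IA JB; apply: idmul_sub => [||x y /IA ? /JB ?];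
  [exact: idmul0|exact: idmulD|exact: mem_idmul].
Qed.

Lemma idmul_ringint_l I : ringint_module I -> idmul ringint I = I.
Proof.
move=> mI; have [_ _ IM] := mI.
apply/seteqP; split; first by apply: idmul_sub_module.
by move=> x Ix; rewrite -[x]mul1r; apply: mem_idmul => //; apply: ringint1.
Qed.

Lemma idmul_ringint_r I : ringint_module I -> idmul I ringint = I.
Proof. by rewrite idmulC; apply: idmul_ringint_l. Qed.

Lemma idmul_module I J : ringint_module J -> ringint_module (idmul I J).
Proof.
case=> J0 JD JM; split; [exact: idmul0|exact: idmulD|].
move=> a x Oa [n [u [v [Iu Jv ->]]]]; rewrite mulr_sumr.
elim/big_ind: _ => [||i _]; [exact: idmul0|exact: idmulD|].
by rewrite mulrCA; apply: mem_idmul => //; apply: JM.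
Qed.

Lemma idinv_module I : ringint_module (idinv I).
Proof.
split=> [y _|x y Ix Iy z Iz|a x Oa Ix y Iy].
- by rewrite mul0r; apply: ringint0.
- by rewrite mulrDl; apply: ringintD; [apply: Ix|apply: Iy].
- by rewrite -mulrA; apply: ringintM => //; apply: Ix.
Qed.

Lemma idmul_idinv_sub I : idmul I (idinv I) `<=` ringint.
Proof.
apply: idmul_sub_module; first exact: ringint_is_module.
by move=> x y Ix; rewrite mulrC; apply.
Qed.

Lemma idinv_unique I J : ringint_module I -> ringint_module J ->
  idmul I J = ringint -> J = idinv I.
Proof.
move=> mI mJ IJ; apply/seteqP; split=> [y Jy x Ix|].
  by rewrite -IJ mulrC; apply: mem_idmul.
rewrite -{1}(idmul_ringint_l (idinv_module I)) -IJ idmulC idmulA.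
rewrite -{2}(idmul_ringint_l mJ).
by apply: idmulS => //; rewrite idmulC; apply: idmul_idinv_sub.
Qed.

Lemma invertibleP I J : ringint_module I -> ringint_module J ->
  idmul I J = ringint -> invertible I.
Proof. by move=> mI mJ IJ; split=> //; rewrite -(idinv_unique mI mJ IJ). Qed.

Lemma invertible_ringint : invertible (ringint : set K).
Proof.
apply: (invertibleP ringint_is_module ringint_is_module).
exact/idmul_ringint_l/ringint_is_module.
Qed.

Lemma invertible_inv I : invertible I -> invertible (idinv I).
Proof.
case=> mI II; apply: (invertibleP (idinv_module I) mI).
by rewrite idmulC.
Qed.

Lemma invertibleM I J : invertible I -> invertible J -> invertible (idmul I J).
Proof.
case=> mI II [mJ JJ].
apply: (@invertibleP _ (idmul (idinv I) (idinv J))).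
- exact: idmul_module.
- exact/idmul_module/idinv_module.
- by rewrite idmulACA II JJ; apply/idmul_ringint_l/ringint_is_module.
Qed.

Lemma idmulK I J : invertible I -> ringint_module J ->
  idmul (idinv I) (idmul I J) = J.
Proof. by case=> mI II mJ; rewrite idmulA (idmulC _ I) II idmul_ringint_l. Qed.

Lemma idmulKV I J : invertible I -> ringint_module J ->
  idmul I (idmul (idinv I) J) = J.
Proof. by case=> mI II mJ; rewrite idmulA II idmul_ringint_l. Qed.

Lemma idmulI I A B : invertible I -> ringint_module A -> ringint_module B ->
  idmul I A = idmul I B -> A = B.
Proof.
by move=> iI mA mB eAB; rewrite -(idmulK iI mA) eAB idmulK.
Qed.

Lemma principal_module x : ringint_module (principal x).
Proof.
split; first by exists 0; [exact: ringint0|rewrite mul0r].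
  by move=> _ _ [a Oa <-] [b Ob <-]; exists (a + b); [exact: ringintD|rewrite mulrDl].
by move=> a _ Oa [b Ob <-]; exists (a * b); [exact: ringintM|rewrite mulrA].
Qed.

Lemma principal_invertible x : x != 0 -> invertible (principal x).
Proof.
move=> x0; apply: (invertibleP (principal_module x) (principal_module x^-1)).
by rewrite -principalM mulfV // principal1.
Qed.

Lemma principal_integral x : ringint x -> x != 0 -> integral_ideal (principal x).
Proof.
move=> Ox x0; have [? ? ?] := principal_module x; split=> //.
  by move=> _ [a Oa <-]; apply: ringintM.
by exists x => //; exists 1; rewrite ?mul1r //; apply: ringint1.
Qed.

Lemma integralM I J : integral_ideal I -> integral_ideal J -> integral_ideal (idmul I J).
Proof.
move=> iI iJ; have [mI mJ] := (integral_module iI, integral_module iJ).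
have [? ? ?] := idmul_module I mJ.
case: iI iJ => [IO _ _ _ [x Ix x0]] [JO _ _ _ [y Jy y0]]; split=> //.
  rewrite -(idmul_ringint_l ringint_is_module); exact: idmulS.
by exists (x * y); [exact: mem_idmul|rewrite mulf_neq0].
Qed.

Lemma integral_eq_ringint I : integral_ideal I -> I 1 -> I = ringint.
Proof.
case=> IO _ _ IM _ I1; apply/seteqP; split=> // x Ox.
by rewrite -[x]mulr1; apply: IM.
Qed.

Lemma idmul_subl I J : integral_ideal I -> integral_ideal J -> idmul I J `<=` I.
Proof.
move=> iI [JO _ _ _ _]; have mI := integral_module iI.
by rewrite -{2}(idmul_ringint_r mI); apply: idmulS.
Qed.

Lemma idmul_subr I J : integral_ideal I -> integral_ideal J -> idmul I J `<=` J.
Proof. by move=> *; rewrite idmulC; apply: idmul_subl. Qed.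

Lemma prime_integral P : prime_ideal P -> integral_ideal P.
Proof. by case. Qed.

Lemma prime_idmul_sub P I J : prime_ideal P -> integral_ideal I -> integral_ideal J ->
  idmul I J `<=` P -> I `<=` P \/ J `<=` P.
Proof.
case=> _ _ Pp [IO _ _ _ _] [JO _ _ _ _] IJP.
case: (pselect (I `<=` P)) => [|nIP]; [by left|right=> y Jy].
have [x Ix nPx] : exists2 x, I x & ~ P x.
  by apply: contra_notP nIP => nex x Ix; apply: contra_notP nex => nPx; exists x.
by case: (Pp x y (IO _ Ix) (JO _ Jy) (IJP _ (mem_idmul Ix Jy))).
Qed.

Lemma not_subset I J : ~ (I `<=` J) -> exists2 x, I x & ~ J x.
Proof.
by move=> nIJ; apply: contra_notP nIJ => nex x Ix; apply: contra_notP nex => nPx; exists x.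
Qed.

(** The ideal [I + (a)]. *)
Definition adjoin I (a : K) : set K :=
  [set x | exists y b, [/\ I y, ringint b & x = y + b * a]].

Lemma adjoin_integral I a : integral_ideal I -> ringint a -> integral_ideal (adjoin I a).
Proof.
case=> IO I0 ID IM [x Ix x0] Oa; split.
- by move=> _ [y [b [Iy Ob ->]]]; apply: ringintD; [exact: IO|exact: ringintM].
- by exists 0, 0; split=> //; [exact: ringint0|rewrite mul0r addr0].
- move=> _ _ [y [b [Iy Ob ->]]] [z [c [Iz Oc ->]]]; exists (y + z), (b + c).
  by split; [exact: ID|exact: ringintD|rewrite mulrDl addrACA].
- move=> c _ Oc [y [b [Iy Ob ->]]]; exists (c * y), (c * b).
  by split; [exact: IM|exact: ringintM|rewrite mulrDr mulrA].
- exists x => //; exists x, 0; split=> //; [exact: ringint0|by rewrite mul0r addr0].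
Qed.

Lemma adjoin_sub I a : I `<=` adjoin I a.
Proof. by move=> x Ix; exists x, 0; split=> //; [exact: ringint0|rewrite mul0r addr0]. Qed.

Lemma adjoin_mem I a : I 0 -> adjoin I a a.
Proof. by move=> I0; exists 0, 1; split=> //; [exact: ringint1|rewrite mul1r add0r]. Qed.

Lemma adjoin_mul_sub I a b : integral_ideal I -> ringint a -> ringint b -> I (a * b) ->
  idmul (adjoin I a) (adjoin I b) `<=` I.
Proof.
move=> iI Oa Ob Iab; have [IO I0 ID IM _] := iI.
apply: idmul_sub_module => [|_ _ [y [c [Iy Oc ->]]] [z [d [Iz Od ->]]]].
  exact: integral_module.
have -> : (y + c * a) * (z + d * b) = (z + d * b) * y + ((c * a) * z + (c * d) * (a * b)).
  by rewrite mulrDl mulrC; congr (_ + _); rewrite mulrDr mulrACA.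
apply: (ID); first by apply: IM => //; apply: ringintD; [exact: IO|exact: ringintM].
by apply: ID; apply: IM => //; apply: ringintM.
Qed.

(** The ideal [I] then contains the product of the strictly larger ideals [I + (a)]
    and [I + (b)], which starts the Noetherian inductions below. *)
Lemma nonprime_witness I : integral_ideal I -> ~ I 1 -> ~ prime_ideal I ->
  exists a b, [/\ ringint a, ringint b, ~ I a, ~ I b & I (a * b)].
Proof.
move=> iI nI1 nP; apply: contra_notP nP => nex; split=> // a b Oa Ob Iab.
apply: contrapT => /not_orP [na nb]; apply: nex; exists a, b; split=> //.
Qed.

End IdealArithmetic.

(** * Finiteness of residue rings *)

(** What is used of a number field: characteristic zero, and any [d + 1] elements
    are linearly dependent over the integers.  Both hold at once for a finite
    extension of Q and for a finite extension of such an extension. *)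
Definition number_field (K : fieldType) : Prop :=
  (forall n, n.+1%:R != 0 :> K) /\
  exists d, forall a : nat -> K, exists c : nat -> int,
    (exists2 i, (i < d.+1)%N & c i != 0) /\ \sum_(i < d.+1) (c i)%:~R * a i = 0.

Section Residues.
Variables (K : fieldType) (HK : number_field K).
Implicit Types (I J P Q : set K) (x y z : K).
Local Open Scope classical_set_scope.

Lemma natr_neq0 n : (0 < n)%N -> n%:R != 0 :> K.
Proof. by case: n => // n _; have [] := HK. Qed.

Definition free_mod (p k : nat) (a : nat -> K) : Prop :=
  (forall i, ringint (a i)) /\ forall (c : nat -> int) z, ringint z ->
    \sum_(i < k) (c i)%:~R * a i = p%:R * z -> forall i, (i < k)%N -> (p %| c i)%Z.

(** Dividing a relation by [p] again and again would make its coefficients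
    infinitely divisible by [p]. *)
Lemma free_mod_relation p k a (c : nat -> int) : (1 < p)%N -> free_mod p k a ->
  \sum_(i < k) (c i)%:~R * a i = 0 -> forall i, (i < k)%N -> c i = 0.
Proof.
move=> p1 [Oa fa]; have p0 : (0 < p)%N by apply: leq_trans p1.
have [n] := ubnP (\sum_(i < k) `|c i|%N)%N; elim: n c => // n IH c lecn Sc0.
have dvd := fa c 0 (@ringint0 K); rewrite mulr0 in dvd; have {}dvd := dvd Sc0.
pose c' i := (c i %/ p)%Z.
have cE i : (i < k)%N -> c i = c' i * p%:Z by move=> /dvd /divzK <-.
have Sc'0 : \sum_(i < k) (c' i)%:~R * a i = 0.
  apply: (mulfI (natr_neq0 p0)); rewrite mulr0 mulr_sumr -[RHS]Sc0.
  by apply: eq_bigr => i _; rewrite mulrA (cE i) ?ltn_ord // intrM [p%:R * _]mulrC.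
move=> i ik; apply/eqP; apply: contraT => ci0.
suff /(IH c') /(_ Sc'0) /(_ i ik) c'i : (\sum_(i < k) `|c' i| < n)%N.
  by rewrite cE // c'i mul0r eqxx in ci0.
rewrite ltnS in lecn; apply: leq_trans lecn; rewrite [in leqRHS](bigD1 (Ordinal ik)) //=.
rewrite (bigD1 (Ordinal ik)) //= -addSn; apply: leq_add.
  rewrite [in leqRHS]cE // abszM /= -[leqLHS]muln1 ltn_mul2l p1 andbT.
  by rewrite absz_gt0; apply: contraNneq ci0 => c'0; rewrite cE // c'0 mul0r.
apply: leq_sum => j _; rewrite [in leqRHS]cE // abszM /=.
by rewrite leq_pmulr.
Qed.

Lemma max_free_mod p : (1 < p)%N ->
  exists k a, free_mod p k a /\ forall b, ~ free_mod p k.+1 b.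
Proof.
move=> p1; apply: contrapT => nmax.
have all_k k : exists a, free_mod p k a.
  elim: k => [|k [a fa]]; first by exists (fun=> 0); split=> // i; apply: ringint0.
  by apply: contrapT => nex; apply: nmax; exists k, a; split=> // b fb; apply: nex; exists b.
have [_ [d rank_d]] := HK; have [a fa] := all_k d.+1.
have [c [[i id ci] Sc]] := rank_d a.
by rewrite (free_mod_relation p1 fa Sc id) eqxx in ci.
Qed.

(** [O / pO] is a vector space over [F_p] of dimension at most the rank: a
    maximal family free modulo [p] spans it. *)
Lemma residues_prime p : prime p -> exists reps : seq K, forall x, ringint x ->
  exists r z, [/\ r \in reps, ringint z & x = r + p%:R * z].
Proof.
move=> pp; have p1 := prime_gt1 pp; have p0 := prime_gt0 pp.
have [k [a [[Oa fa] amax]]] := max_free_mod p1.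
exists [seq \sum_(i < k) (f i)%:R * a i | f : {ffun 'I_k -> 'I_p}] => x Ox.
pose b i := if (i < k)%N then a i else x.
have bE (c : nat -> int) : \sum_(i < k) (c i)%:~R * b i = \sum_(i < k) (c i)%:~R * a i.
  by apply: eq_bigr => i _; rewrite /b ltn_ord.
have Ob i : ringint (b i) by rewrite /b; case: ifP.
have /asboolPn/existsp_asboolPn [c nc] : ~ forall c : nat -> int, forall z, ringint z ->
    \sum_(i < k.+1) (c i)%:~R * b i = p%:R * z -> forall i, (i < k.+1)%N -> (p %| c i)%Z.
  by move=> fb; apply: (amax b).
have {nc} [z [Oz Sc nc]] : exists z, [/\ ringint z,
    \sum_(i < k.+1) (c i)%:~R * b i = p%:R * z & ~ forall i, (i < k.+1)%N -> (p %| c i)%Z].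
  by apply: contra_notP nc => nex z Oz Sc; apply: contrapT => h; apply: nex; exists z.
move: Sc; rewrite big_ord_recr /= bE /b ltnn => Sc.
have npc : ~~ (p %| c k)%Z.
  apply/negP=> /divzK ck; apply: nc => i; rewrite ltnS leq_eqVlt => /predU1P[->|ik].
    by rewrite -ck dvdz_mull.
  apply: (fa c (z - (c k %/ p)%Z%:~R * x)) => //.
    by apply: ringintB => //; apply/ringintM => //; apply: ringint_int.
  rewrite mulrBr -Sc -{1}ck intrM mulrA [p%:R * _]mulrC -[p%:~R]/(p%:R).
  by rewrite addrK.
have /coprimezP [[u v] /= uv] : coprimez (c k) p.
  by rewrite /coprimez -[gcdz _ _]/(Posz (gcdn `|c k| p)) gcdnC; apply/eqP; congr Posz;
     apply/eqP; move: npc; rewrite /dvdz /= -(prime_coprime _ pp).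
pose e i := - (u * c i).
pose q i := (e i %/ p)%Z.
have eE i : e i = q i * p%:Z + (absz (e i %% p)%Z)%:Z.
  by rewrite gez0_abs ?modz_ge0 -?divz_eq // -lt0n.
have lt_e i : (absz (e i %% p)%Z < p)%N.
  by rewrite -ltz_nat gez0_abs ?modz_ge0 ?ltz_pmod // -lt0n.
exists (\sum_(i < k) ([ffun i : 'I_k => Ordinal (lt_e i)] i)%:R * a i).
exists (\sum_(i < k) (q i)%:~R * a i + u%:~R * z + v%:~R * x); split.
- by apply/fintype.imageP; exists [ffun i : 'I_k => Ordinal (lt_e i)].
- apply: ringintD; last by apply/ringintM => //; apply: ringint_int.
  apply: ringintD; last by apply/ringintM => //; apply: ringint_int.
  by apply: ringint_sum => i; apply: ringintM => //; apply: ringint_int.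
have xE : x = \sum_(i < k) (e i)%:~R * a i + p%:R * (u%:~R * z + v%:~R * x).
  transitivity ((u * c k + v * p)%:~R * x); first by rewrite uv mul1r.
  have -> : \sum_(i < k) (e i)%:~R * a i = - u%:~R * \sum_(i < k) (c i)%:~R * a i.
    by rewrite mulr_sumr; apply: eq_bigr => i _; rewrite mulrA mulNr /e rmorphN rmorphM.
  rewrite mulrDr [p%:R * (u%:~R * z)]mulrCA -Sc mulrDr addrA mulNr addKr.
  by rewrite intrD !intrM mulrDl -mulrA; congr (_ + _); rewrite mulrA [v%:~R * _]mulrC.
rewrite {1}xE -addrA [in RHS]mulrDr addrA; congr (_ + _).
rewrite mulr_sumr -big_split /=; apply: eq_bigr => i _.
by rewrite ffunE /= {1}eE intrD intrM mulrDl addrC mulrA [p%:R * _]mulrC !pmulrn.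
Qed.

Lemma residues_finite n : (0 < n)%N -> exists reps : seq K, forall x, ringint x ->
  exists r z, [/\ r \in reps, ringint z & x = r + n%:R * z].
Proof.
elim/ltn_ind: n => n IH n0; have [n1|n1] := leqP n 1.
  exists [:: 0] => x Ox; exists 0, x; split; rewrite ?inE //.
  by rewrite (eqP (_ : n == 1%N)) ?eqn_leq ?n1 // mul1r add0r.
have pp := pdiv_prime n1; have p0 := pdiv_gt0 n.
have nE : n = (pdiv n * (n %/ pdiv n))%N by rewrite mulnC divnK ?pdiv_dvd.
have [|| s Hs] := IH (n %/ pdiv n)%N; first by rewrite ltn_Pdiv ?prime_gt1.
  by rewrite divn_gt0 // pdiv_leq.
have [t Ht] := residues_prime pp.
exists [seq r + (pdiv n)%:R * r' | r <- t, r' <- s] => x Ox.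
have [r [y [tr Oy ->]]] := Ht x Ox; have [r' [z [sr' Oz ->]]] := Hs y Oy.
exists (r + (pdiv n)%:R * r'), z; split=> //; first by apply: allpairs_f.
by rewrite mulrDr addrA mulrA -natrM -nE.
Qed.

(** Pigeonhole principle in the finite ring [O / nO]. *)
Lemma residues_collide n (f : nat -> K) : (0 < n)%N -> (forall i, ringint (f i)) ->
  exists i j z, [/\ (i < j)%N, ringint z & f j - f i = n%:R * z].
Proof.
move=> n0 Of; have [reps Hr] := residues_finite n0.
have [g Hg] := choice (fun i => Hr (f i) (Of i)).
have g_reps i : g i \in reps by case: (Hg i) => z [].
pose N := (size reps).+1.
pose ix (i : 'I_N) : 'I_N := inord (index (g i) reps).
have lt_reps i : (index (g i) reps < N)%N by rewrite ltnS index_size.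
have [i [j [ij gij]]] : exists i j, (i < j)%N /\ g i = g j.
  have /injectivePn [i [j ij hij]] : 
      ~~ injectiveb (fun l : 'I_N.+1 => Ordinal (lt_reps l)).
    by apply/negP=> /injectiveP /leq_card; rewrite !card_ord ltnn.
  have gij : g i = g j.
    have /= eij := congr1 val hij.
    by rewrite -(nth_index 0 (g_reps i)) eij nth_index.
  by move: ij; rewrite neq_ltn => /orP[ij|ji]; [exists i, j|exists j, i].
have [[z [_ Oz fi]] [w [_ Ow fj]]] := (Hg i, Hg j).
exists i, j, (w - z); split=> //; first exact: ringintB.
by rewrite fi fj gij mulrBr opprD addrACA subrr add0r.
Qed.

End Residues.

(** * Ideals of number fields *)

Section DedekindTheory.
Variables (K : fieldType) (HK : number_field K).
Implicit Types (I J A B C E P Q : set K) (x y z : K).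
Local Open Scope classical_set_scope.

(** The constant coefficient of an integral equation of [x] is a multiple
    of [x]. *)
Lemma ideal_has_nat I : integral_ideal I -> exists2 n, (0 < n)%N & I n%:R.
Proof.
move=> iI; have mI := integral_module iI.
case: iI => [IO I0 ID IM [x Ix x0]]; have [p /monic_neq0 p0 px] := IO x Ix.
elim/poly_ind: p p0 px => [|q c IH] p0 px; first by rewrite eqxx in p0.
move: px; rewrite rmorphD rmorphM /= map_polyX map_polyC /root !hornerE /= => /eqP qxc.
have [c0|c0] := eqVneq c 0.
  move: p0 qxc; rewrite c0 !addr0 => p0 /eqP; rewrite mulf_eq0 (negPf x0) orbF.
  by apply: IH; apply: contraNneq p0 => ->; rewrite mul0r.
have Ic : I c%:~R.
  have -> : c%:~R = (- (map_poly intr q).[x]) * x.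
    by rewrite mulNr; apply/eqP; rewrite -addr_eq0 addrC qxc.
  apply: IM => //; apply/ringintN/integral_horner; last exact: IO.
  by apply/integral_poly=> i; rewrite coef_map; apply: integral_id.
case: c Ic c0 {p0 qxc} => n In n0.
  by exists n; rewrite ?lt0n // pmulrn.
by exists n.+1 => //; move: (moduleN mI In); rewrite NegzE mulrNz opprK pmulrn.
Qed.

(** Noetherian induction: all ideals between [I] and [O] contain a fixed integer
    [n], hence are determined by the finitely many residues modulo [n] that they
    contain. *)
Lemma ideal_ind (R : set K -> Prop) :
  (forall I, integral_ideal I ->
     (forall J, integral_ideal J -> I `<=` J -> ~ (J `<=` I) -> R J) -> R I) ->
  forall I, integral_ideal I -> R I.
Proof.
move=> step I iI; have [n n0 In] := ideal_has_nat iI.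
have [reps Hr] := residues_finite HK n0.
pose miss J := [pred r | `[< ~ J r >]].
have [N] := ubnP (count (miss I) reps); elim: N I iI In => // N IH I iI In ltN.
apply: step => // J iJ IJ /not_subset [x Jx nIx]; apply: (IH J iJ (IJ _ In)).
move: ltN; rewrite ltnS; apply: leq_trans.
have [IO I0 ID IM _] := iI; have [JO J0 JD JM _] := iJ.
have [r [z [rr Oz xE]]] := Hr x (JO x Jx).
have Inz : I (n%:R * z) by rewrite mulrC; apply: IM.
have Jr : J r.
  have -> : r = x - n%:R * z by rewrite xE addrK.
  by apply: (moduleB (integral_module iJ)) => //; apply: IJ.
have nIr : ~ I r by move=> Ir; apply: nIx; rewrite xE; apply: ID.
have le s : (count (miss J) s <= count (miss I) s)%N.
  by apply: sub_count => s' /asboolP nJ; apply/asboolP => /IJ.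
elim: reps rr {Hr IH} => //= s reps IHr; rewrite inE => /predU1P[<-|/IHr lt].
  have nnJr : ~ ~ J r by [].
  by rewrite (asboolT nIr) (asboolF nnJr) add0n add1n ltnS.
rewrite -addnS; apply: leq_add => //.
by case: asboolP => // nJ; rewrite asboolT // => /IJ.
Qed.

(** By the pigeonhole principle two of the elements [n y^k] are congruent modulo
    [nO], so that [y^j - y^i] is an algebraic integer for some [i < j]; this gives an
    integral equation for [y]. *)
Lemma bounded_powers_ringint n y : (0 < n)%N ->
  (forall k, ringint (n%:R * y ^+ k)) -> ringint y.
Proof.
move=> n0 /(residues_collide HK n0) [i [j [z [ij Oz]]]].
rewrite -mulrBr => /(mulfI (natr_neq0 HK n0)) yE.
have pmon : 'X^j - ('X^i + z%:P) \is monic.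
  rewrite monicE lead_coefDl ?lead_coefXn // size_polyN size_polyXn.
  apply: leq_ltn_trans (size_polyD _ _) _; rewrite gtn_max size_polyXn ltnS ij /=.
  by apply: leq_ltn_trans (size_polyC_leq1 _) _; rewrite ltnS (leq_trans _ ij).
apply: (integral_root_monic pmon).
  by rewrite /root !hornerE -yE [_ + (_ - _)]addrC subrK subrr.
apply/integral_poly => k; rewrite !coefE.
apply: ringintB; first exact: ringint_nat.
by apply: ringintD; [exact: ringint_nat|case: ifP => _ //; exact: ringint0].
Qed.

Lemma ideal_stabilizer I y : integral_ideal I -> (forall x, I x -> I (y * x)) -> ringint y.
Proof.
move=> iI Iy; have [n n0 In] := ideal_has_nat iI; have [IO _ _ _ _] := iI.
apply: (bounded_powers_ringint n0) => k; apply: IO.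
elim: k => [|k IH]; first by rewrite mulr1.
by rewrite exprS mulrCA; apply: Iy.
Qed.

(** [O / P] is a finite domain, hence a field. *)
Lemma prime_maximal P J : prime_ideal P -> integral_ideal J -> P `<=` J -> ~ J 1 -> J = P.
Proof.
move=> pP iJ PJ nJ1; have iP := prime_integral pP; have [JO _ _ JM _] := iJ.
have [_ nP1 Pp] := pP; have [PO P0 PD PM _] := iP.
apply/seteqP; split=> // x Jx; apply: contrapT => nPx.
have Ox := JO x Jx; have [n n0 Pn] := ideal_has_nat iP.
have [i [j [z [ij Oz xE]]]] := residues_collide HK n0 (fun k => ringintX k Ox).
have nPX k : ~ P (x ^+ k).
  elim: k => [|k IH]; first by rewrite expr0.
  by rewrite exprS => /Pp; case=> //; apply: ringintX.
have : P (x ^+ i * (x ^+ (j - i) - 1)).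
  by rewrite mulrBr mulr1 -exprD subnKC ?(ltnW ij) // xE mulrC; apply: PM.
case/Pp; [exact: ringintX|by apply: ringintB; [exact: ringintX|exact: ringint1]|exact: nPX|].
move=> /PJ Jx1; apply: nJ1; rewrite -[1](subKr (x ^+ (j - i))).
apply: (moduleB (integral_module iJ)) => //.
by rewrite -(subnSK ij) exprSr; apply: JM => //; apply: ringintX.
Qed.

Lemma prime_sub_eq P Q : prime_ideal P -> prime_ideal Q -> P `<=` Q -> Q = P.
Proof.
by move=> pP [iQ nQ1 _] PQ; apply: prime_maximal.
Qed.

Lemma adjoin_larger I a : I 0 -> ~ I a -> ~ (adjoin I a `<=` I).
Proof. by move=> I0 nIa sub; apply/nIa/sub/adjoin_mem. Qed.

Lemma proper_sub_prime I : integral_ideal I -> ~ I 1 -> exists2 P, prime_ideal P & I `<=` P.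
Proof.
elim/ideal_ind => {}I iI IH nI1; have [pI|npI] := pselect (prime_ideal I); first by exists I.
have [a [b [Oa Ob nIa nIb Iab]]] := nonprime_witness iI nI1 npI.
have [IO I0 _ _ _] := iI.
have [a1|na1] := pselect (adjoin I a 1); last first.
  have [P pP IaP] := IH _ (adjoin_integral iI Oa) (@adjoin_sub _ _ _) (adjoin_larger I0 nIa) na1.
  by exists P => //; apply: subset_trans IaP; apply: adjoin_sub.
have [b1|nb1] := pselect (adjoin I b 1); last first.
  have [P pP IbP] := IH _ (adjoin_integral iI Ob) (@adjoin_sub _ _ _) (adjoin_larger I0 nIb) nb1.
  by exists P => //; apply: subset_trans IbP; apply: adjoin_sub.
case: nI1; apply: (adjoin_mul_sub iI Oa Ob Iab); rewrite -[1]mulr1; exact: mem_idmul.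
Qed.

Definition ideal_prod (s : seq (set K)) : set K := foldr (@idmul K) ringint s.

Lemma ideal_prod_integral s : (forall P, P \in s -> prime_ideal P) ->
  integral_ideal (ideal_prod s).
Proof.
elim: s => [|P s IH] ps; first exact: integral_ringint.
apply: integralM; first by apply/prime_integral/ps; rewrite mem_head.
by apply: IH => Q sQ; apply: ps; rewrite inE sQ orbT.
Qed.

Lemma ideal_prod_cat s t : (forall P, P \in t -> prime_ideal P) ->
  ideal_prod (s ++ t) = idmul (ideal_prod s) (ideal_prod t).
Proof.
move=> pt; elim: s => [|P s IH] /=; last by rewrite IH idmulA.
by rewrite idmul_ringint_l //; apply/integral_module/ideal_prod_integral.
Qed.

Lemma contains_prime_prod I : integral_ideal I ->
  exists2 s, (forall P, P \in s -> prime_ideal P) & ideal_prod s `<=` I.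
Proof.
elim/ideal_ind => {}I iI IH; have [IO I0 _ _ _] := iI.
have [I1|nI1] := pselect (I 1); first by exists [::]; rewrite //= (integral_eq_ringint iI I1).
have [pI|npI] := pselect (prime_ideal I).
  exists [:: I] => [P|]; first by rewrite inE => /eqP ->.
  by rewrite /= idmul_ringint_r //; apply: integral_module.
have [a [b [Oa Ob nIa nIb Iab]]] := nonprime_witness iI nI1 npI.
have [s ps sI] := IH _ (adjoin_integral iI Oa) (@adjoin_sub _ _ _) (adjoin_larger I0 nIa).
have [t pt tI] := IH _ (adjoin_integral iI Ob) (@adjoin_sub _ _ _) (adjoin_larger I0 nIb).
exists (s ++ t) => [P|]; first by rewrite mem_cat => /orP[/ps|/pt].
rewrite ideal_prod_cat //; apply: subset_trans (adjoin_mul_sub iI Oa Ob Iab).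
exact: idmulS.
Qed.

Lemma prime_sub_prod P s : prime_ideal P -> (forall Q, Q \in s -> prime_ideal Q) ->
  ideal_prod s `<=` P -> P \in s.
Proof.
move=> pP; elim: s => [|Q s IH] ps /= sP.
  by have [_ nP1 _] := pP; case: nP1; apply/sP/ringint1.
have ps' R : R \in s -> prime_ideal R by move=> sR; apply: ps; rewrite inE sR orbT.
have pQ : prime_ideal Q by apply: ps; rewrite mem_head.
have iPs := ideal_prod_integral ps'; rewrite inE.
have [QP|/(IH ps') ->] := prime_idmul_sub pP (prime_integral pQ) iPs sP.
  by rewrite (prime_sub_eq pQ pP QP) eqxx.
by rewrite orbT.
Qed.

(** Take [x] in [P] and a product of primes inside [(x)] with as few factors as
    possible.  One of the factors is [P]; the product of the others contains some
    [y] outside [(x)], and [y / x] is the element sought. *)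
Lemma prime_inverse_nontrivial P : prime_ideal P -> exists2 y, idinv P y & ~ ringint y.
Proof.
move=> pP; have [[PO P0 PD PM [x Px x0]] nP1 _] := pP.
have [s ps sx] := contains_prime_prod (principal_integral (PO x Px) x0).
have xP : principal x `<=` P by move=> _ [a Oa <-]; apply: PM.
have [n] := ubnP (size s); elim: n s ps sx => // n IH s ps sx ltn.
have sP := prime_sub_prod pP ps (subset_trans sx xP).
have sE : ideal_prod s = idmul P (ideal_prod (rem P s)).
  elim: s sP {ps sx ltn} => //= Q s IHs; rewrite inE => /predU1P[->|sP].
    by rewrite eqxx.
  by case: eqVneq => [->//|_] /=; rewrite (IHs sP) idmulA (idmulC Q) -idmulA.
have pr Q : Q \in rem P s -> prime_ideal Q by move=> /mem_rem /ps.
have [rx|/not_subset [y ry nxy]] := pselect (ideal_prod (rem P s) `<=` principal x).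
  apply: (IH _ pr rx); rewrite size_rem //.
  by case: (s) sP ltn.
exists (y / x) => [z Pz|Oyx]; last by apply: nxy; exists (y / x); rewrite ?divfK.
have [a Oa azx] : principal x (z * y) by apply: sx; rewrite sE; apply: mem_idmul.
by rewrite mulrC mulrA -azx mulfK.
Qed.

Lemma ideal_sub_idinv_mul P I : integral_ideal P -> integral_ideal I -> I `<=` idmul (idinv P) I.
Proof.
case=> PO _ _ _ _ iI; have mI := integral_module iI.
rewrite -{1}(idmul_ringint_l mI); apply: idmulS => // x Ox y Py.
by apply: ringintM => //; apply: PO.
Qed.

(** Multiplying by the inverse of a prime enlarges an ideal strictly, for
    otherwise all elements of the inverse would be integral. *)
Lemma prime_inverse_larger P I : prime_ideal P -> integral_ideal I ->
  ~ (idmul (idinv P) I `<=` I).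
Proof.
move=> pP iI sub; have [y Py nOy] := prime_inverse_nontrivial pP.
apply: nOy; apply: (ideal_stabilizer iI) => x Ix; apply: sub; exact: mem_idmul.
Qed.

(** [P] times its inverse is an ideal strictly larger than the maximal ideal [P]. *)
Lemma prime_invertible P : prime_ideal P -> invertible P.
Proof.
move=> pP; have iP := prime_integral pP; have mP := integral_module iP.
split=> //; have [_ _ _ _ [x Px x0]] := iP; rewrite idmulC.
have larger := prime_inverse_larger pP iP.
have sub := ideal_sub_idinv_mul iP iP.
have iI : integral_ideal (idmul (idinv P) P).
  have [? ? ?] := idmul_module (idinv P) mP; split=> //.
    by rewrite idmulC; apply: idmul_idinv_sub.
  by exists x => //; apply: sub.
apply: integral_eq_ringint => //; apply: contrapT => n1.
by apply: larger; rewrite (prime_maximal pP iI sub n1).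
Qed.

(** For invertible ideals, to contain is to divide. *)
Lemma cofactor_integral E I : invertible E -> integral_ideal I -> I `<=` E ->
  integral_ideal (idmul (idinv E) I) /\ idmul E (idmul (idinv E) I) = I.
Proof.
move=> iE iI IE; have mI := integral_module iI; have EK := idmulKV iE mI.
split=> //; have [? ? ?] := idmul_module (idinv E) mI; split=> //.
  apply: idmul_sub_module => [|x y Ex Iy]; first exact: ringint_is_module.
  by apply/Ex/IE.
apply: contrapT => nex; have [_ _ _ _ [x Ix /eqP]] := iI; apply.
move: Ix; rewrite -EK => -[n [a [b [_ Jb ->]]]].
apply: big1 => i _; suff -> : b i = 0 by rewrite mulr0.
by apply/eqP; apply: contrapT => /negP bi; apply: nex; exists (b i).
Qed.

(** Factorization into primes, as an induction principle: dividing [I] by a prime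
    that contains it gives a strictly larger ideal. *)
Lemma prime_factor_ind (R : set K -> Prop) : R ringint ->
  (forall P I, prime_ideal P -> integral_ideal I -> R I -> R (idmul P I)) ->
  forall I, integral_ideal I -> R I.
Proof.
move=> R1 RM; apply: ideal_ind => I iI IH.
have [I1|nI1] := pselect (I 1); first by rewrite (integral_eq_ringint iI I1).
have [P pP IP] := proper_sub_prime iI nI1; have iP := prime_integral pP.
have [iJ PJ] := cofactor_integral (prime_invertible pP) iI IP.
rewrite -PJ; apply: RM => //; apply: IH => //; first exact: ideal_sub_idinv_mul.
exact: prime_inverse_larger.
Qed.

Lemma integral_invertible I : integral_ideal I -> invertible I.
Proof.
elim/prime_factor_ind => [|P {}I pP iI]; first exact: invertible_ringint.
exact/invertibleM/prime_invertible.
Qed.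

(** If [E] is the product of [P] and [E'], with [E'] not inside [P], then [I = E' J] by
    induction, and [P] has to contain the factor [J]. *)
Lemma squarefree_divides E I : integral_ideal E -> integral_ideal I ->
  (forall Q, prime_ideal Q -> ~ iddvd (idmul Q Q) E) ->
  (forall Q, prime_ideal Q -> E `<=` Q -> I `<=` Q) -> I `<=` E.
Proof.
move=> + iI; elim/prime_factor_ind => [|P {}E pP iE IH] sqf sub.
  by case: iI.
have iP := prime_integral pP; have [iPE mE] := (integralM iP iE, integral_module iE).
have PE_E := idmul_subr iP iE.
have IE : I `<=` E.
  apply: IH => [Q pQ [C iC EE]|Q pQ EQ]; last first.
    by apply: sub => //; apply: subset_trans EQ.
  apply: (sqf Q pQ); exists (idmul P C); first exact: integralM.
  by rewrite EE idmulA (idmulC P) -idmulA.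
have [iJ EJ] := cofactor_integral (integral_invertible iE) iI IE.
have IP : I `<=` P by apply: sub => //; apply: idmul_subl.
have [EP|JP] : E `<=` P \/ idmul (idinv E) I `<=` P.
  by apply: prime_idmul_sub => //; rewrite EJ.
  have [iC PC] := cofactor_integral (prime_invertible pP) iE EP.
  by case: (sqf P pP); exists (idmul (idinv P) E); rewrite // -{1}PC idmulA.
by rewrite -EJ idmulC; apply: idmulS.
Qed.

End DedekindTheory.

(** * Number fields *)

Lemma number_field_rat (K : fieldExtType rat) : number_field K.
Proof.
split=> [n|].
  rewrite -[_%:R](rmorph_nat (in_alg K)) /= scaler_eq0 oner_eq0 orbF.
  by rewrite pnatr_eq0.
exists (\dim {:K}) => a; set d := \dim _.
pose X := [tuple a i | i < d.+1].
have /freeP nfX : ~~ free X.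
  apply/negP=> /eqP; move: (dimvS (subvf <<X>>%VS)); rewrite size_tuple => + eX.
  by rewrite eX ltnn.
have [k [Sk [i ki]]] : exists k : 'I_d.+1 -> rat, \sum_i k i *: X`_i = 0 /\ exists i, k i != 0.
  apply: contra_notP nfX => nex k Sk i; apply/eqP; apply: contraT => ki.
  by case: nex; exists k; split=> //; exists i.
(* [c] is [k] times the product of all denominators. *)
pose D j := \prod_(l < d.+1 | l != j) denq (k l).
pose c n := if insub n is Some j then numq (k j) * D j else 0.
have cE (j : 'I_d.+1) : c j = numq (k j) * D j by rewrite /c valK.
exists c; split.
  exists i => //; rewrite cE mulf_neq0 ?numq_eq0 //.
  by apply/prodf_neq0 => j _; rewrite denq_neq0.
have cR (j : 'I_d.+1) : (c j)%:~R = (\prod_l denq (k l))%:~R * k j.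
  rewrite cE (bigD1 j) //= -/(D j) !intrM numqE -mulrA [LHS]mulrC [RHS]mulrCA.
  by rewrite [_ * k j]mulrC.
transitivity ((\prod_l denq (k l))%:~R *: \sum_i k i *: X`_i); last by rewrite Sk scaler0.
rewrite scaler_sumr; apply: eq_bigr => j _.
rewrite scalerA -cR -(tnth_nth 0) tnth_mktuple -[in LHS](rmorph_int (in_alg K)) /=.
by rewrite mulr_algl.
Qed.

(** [baseFieldType L] is [L] itself, seen as an extension of Q. *)
Lemma number_field_ext (F : fieldExtType rat) (L : fieldExtType F) : number_field L.
Proof. exact: (number_field_rat (baseFieldType L)). Qed.

(** * Galois action on ideals *)

Section GaloisIdeals.
Variables (F : fieldExtType rat) (L : splittingFieldType F).
Hypothesis galL : galois 1 {:L}.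
Implicit Types (s : gal_of {:L}) (I J P Q : set L) (p a : set F).
Local Open Scope classical_set_scope.

Let HL : number_field L := number_field_ext L.
Let HF : number_field F := number_field_rat F.

Lemma mem_gal1 s : s \in 'Gal({:L} / 1)%g.
Proof. by rewrite gal_kHom ?sub1v // k1AHom. Qed.

Lemma gal_alg s (z : F) : s z%:A = z%:A.
Proof. by rewrite linearZ /= rmorph1. Qed.

Lemma gal_fixed (x : L) : (forall s, s x = x) -> exists z : F, x = z%:A.
Proof.
move=> fx; apply/vlineP; have /galois_fixedField <- := galL.
by apply/fixedFieldP => [|s _]; rewrite ?memvf.
Qed.

(** By independence of automorphisms some sum of the [c(s)^-1 s(a)] is not zero. *)
Lemma hilbert90 (c : gal_of {:L} -> L) : (forall s, c s != 0) ->
  (forall s t, c (s * t)%g = t (c s) * c t) ->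
  exists2 x, x != 0 & forall s, s x = c s * x.
Proof.
move=> c0 cM.
have [||a _ b0] := @gal_independent_contra _ _ {:L} predT (fun s => (c s)^-1) 1%g.
- by [].
- by rewrite invr_eq0.
exists (\sum_s (c s)^-1 * s a) => // s.
rewrite rmorph_sum mulr_sumr [RHS](reindex_inj (mulIg s)) /=.
apply: eq_bigr => t _; rewrite rmorphM fmorphV galM ?memvf // cM invfM.
by rewrite mulrA [c s * _]mulrCA mulfV // mulr1.
Qed.

Lemma image_gal_module s I : ringint_module I -> ringint_module (s @` I).
Proof.
case=> I0 ID IM; split=> [|x y /image_galE Ix /image_galE Iy|a x Oa /image_galE Ix];
  apply/image_galE; rewrite ?rmorph0 ?rmorphD ?rmorphM //; first exact: ID.
by apply: IM => //; apply: ringint_gal.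
Qed.

Lemma image_gal_integral s I : integral_ideal I -> integral_ideal (s @` I).
Proof.
move=> iI; have [? ? ?] := image_gal_module s (integral_module iI).
case: iI => IO _ _ _ [x Ix x0]; split=> //.
  by move=> _ [y Iy <-]; apply/ringint_gal/IO.
by exists (s x); [exists x|rewrite fmorph_eq0].
Qed.

(** The Galois group permutes transitively the primes above a given prime.
    Otherwise the Chinese remainder theorem gives [y] in [Q], congruent to 1 modulo
    all conjugates of [P]; its norm lies in [Q] and in the base field, hence in [P],
    so that some conjugate of [y] lies in [P]. *)
Lemma gal_transitive P Q : prime_ideal P -> prime_ideal Q ->
  contracted_ideal P = contracted_ideal Q -> exists s, Q = s @` P.
Proof.
move=> pP pQ ePQ; apply: contrapT => nex.
have [[PO P0 PD PM _] nP1 Pp] := pP; have [[QO Q0 QD QM _] _ _] := pQ.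
have mQ := integral_module (prime_integral pQ).
(* [Q] and [s P] are comaximal: [f s] is the component of 1 in [s P]. *)
have /choice[f fE] : forall s, exists x, [/\ (s @` P) x, ringint x & Q (1 - x)].
  move=> s; have psP := image_gal_prime s pP; have isP := prime_integral psP.
  have [sP0 _ _] := integral_module isP.
  have [x Qx nPx] : exists2 x, Q x & ~ (s @` P) x.
    by apply: not_subset => QsP; case: nex; exists s; rewrite (prime_sub_eq HL pQ psP QsP).
  have [y [b [Py Ob e1]]] : adjoin (s @` P) x 1.
    apply: contrapT => n1; apply: nPx.
    rewrite -(prime_maximal HL psP (adjoin_integral isP (QO x Qx)) (@adjoin_sub _ _ _) n1).
    exact: adjoin_mem.
  exists y; split=> //; first by case: isP => sPO _ _ _ _; apply: sPO.
  by rewrite e1 [y + _]addrC addrK; apply: QM.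
have Of s : ringint (f s) by case: (fE s).
pose y := 1 - \prod_(s : gal_of {:L}) f s.
have Qy : Q y.
  suff [] : ringint (\prod_(s : gal_of {:L}) f s) /\ Q y by [].
  rewrite /y; elim/big_ind: _ => [|u v [Ou Qu] [Ov Qv]|s _].
  - by split; [exact: ringint1|rewrite subrr].
  - split; first exact: ringintM.
    have -> : 1 - u * v = (1 - u) + u * (1 - v) by rewrite mulrBr mulr1 addrA subrK.
    by apply: QD => //; apply: QM.
  - by have [] := fE s.
have nPy s : ~ P (s y).
  rewrite -{1}[s]invgK => /image_galE Py; have psP := image_gal_prime s^-1%g pP.
  have [isP nsP1 _] := psP; apply: nsP1; rewrite -[1](subrK (\prod_t f t)) -/y.
  have [_ _ sPD sPM _] := isP; apply: sPD => //.
  rewrite (bigD1 s^-1%g) //= mulrC; apply: sPM; last by have [] := fE s^-1%g.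
  by elim/big_ind: _ => [||t _]; [exact: ringint1|exact: ringintM|].
have [z zE] : exists z : F, \prod_(s : gal_of {:L}) s y = z%:A.
  apply: gal_fixed => s; rewrite rmorph_prod [RHS](reindex_inj (mulIg s)).
  by apply: eq_bigr => t _; rewrite galM ?memvf.
have Oy := QO y Qy.
have : P (\prod_(s : gal_of {:L}) s y).
  have -> : P (\prod_(s : gal_of {:L}) s y) = contracted_ideal P z by rewrite zE.
  rewrite ePQ /contracted_ideal /= -zE (bigD1 1%g) //= gal_id mulrC; apply: QM => //.
  by elim/big_ind: _ => [||t _]; [exact: ringint1|exact: ringintM|exact: ringint_gal].
suff [] : ringint (\prod_(s : gal_of {:L}) s y) /\ ~ P (\prod_(s : gal_of {:L}) s y) by [].
elim/big_ind: _ => [|u v [Ou nPu] [Ov nPv]|s _].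
- by split=> //; exact: ringint1.
- by split; [exact: ringintM|case/Pp].
- by split; [exact: ringint_gal|exact: nPy].
Qed.

Lemma algM (y z : F) : (y * z)%:A = y%:A * z%:A :> L.
Proof. exact: (rmorphM (in_alg L)). Qed.

Lemma ringint_alg (z : F) : ringint (z%:A : L) <-> ringint z.
Proof.
have mapE (q : {poly int}) : map_poly (intr : int -> L) q = map_poly (in_alg L) (map_poly intr q).
  by rewrite -map_poly_comp; apply: eq_map_poly => i; rewrite -(rmorph_int (in_alg L)).
split=> -[q mq]; rewrite ?mapE => rq; exists q => //.
  by move: rq; rewrite (fmorph_root (in_alg L)).
by rewrite mapE (fmorph_root (in_alg L)).
Qed.

Lemma contracted_prime P : prime_ideal P -> prime_ideal (contracted_ideal P : set F).
Proof.
move=> pP; have [[PO P0 PD PM _] nP1 Pp] := pP; split; first split.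
- by move=> z Pz; apply/ringint_alg/PO.
- by rewrite /contracted_ideal /= scale0r.
- by move=> y z; rewrite /contracted_ideal /= scalerDl; apply: PD.
- move=> a z /ringint_alg Oa; by rewrite /contracted_ideal /= algM; apply: PM.
- have [n n0 Pn] := ideal_has_nat (prime_integral pP).
  by exists n%:R; [rewrite /contracted_ideal /= scaler_nat|exact: (natr_neq0 HF n0)].
- by rewrite /contracted_ideal /= scale1r.
- move=> a b /ringint_alg Oa /ringint_alg Ob.
  by rewrite /contracted_ideal /= algM; apply: Pp.
Qed.

Local Notation ext := (@extended_ideal F L).

Lemma mem_ext a (z : F) : a z -> ext a z%:A.
Proof. by move=> az; rewrite -[_%:A]mulr1; apply: mem_idmul; [exists z|exact: ringint1]. Qed.

Lemma ext_module a : ringint_module (ext a).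
Proof. exact/idmul_module/ringint_is_module. Qed.

Lemma ext_sub a I : ringint_module I -> (forall z, a z -> I z%:A) -> ext a `<=` I.
Proof.
move=> mI aI; apply: idmul_sub_module => // _ y [z az <-] Oy.
by rewrite mulrC; have [_ _ IM] := mI; apply: IM => //; apply: aI.
Qed.

Lemma image_alg_idmul a b : [set x%:A | x in idmul a b] =
  idmul [set x%:A | x in a] [set x%:A | x in b] :> set L.
Proof.
apply/seteqP; split.
  move=> _ [_ [n [u [v [au bv ->]]]] <-]; exists n, (fun i => (u i)%:A), (fun i => (v i)%:A).
  split=> [i|i|]; [by exists (u i)|by exists (v i)|].
  by rewrite scaler_suml; apply: eq_bigr => i _; rewrite algM.
apply: idmul_sub => [|_ _ [u abu <-] [v abv <-]|_ _ [u au <-] [v bv <-]].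
- by exists 0; rewrite ?scale0r //; apply: idmul0.
- by exists (u + v); rewrite ?scalerDl //; apply: idmulD.
- exists (u * v); first exact: mem_idmul.
  by rewrite algM.
Qed.

Lemma extM a b : ext (idmul a b) = idmul (ext a) (ext b).
Proof.
rewrite /extended_ideal image_alg_idmul -{1}(idmul_ringint_l (@ringint_is_module L)).
by rewrite idmulACA.
Qed.

Lemma ext_ringint : ext ringint = ringint.
Proof.
apply/seteqP; split; last first.
  move=> y Oy; rewrite -[y]mul1r; apply: mem_idmul => //.
  by exists 1; [exact: ringint1|exact: scale1r].
by apply: ext_sub => [|z /ringint_alg //]; exact: ringint_is_module.
Qed.

Lemma ext_principal (z : F) : ext (principal z) = principal (z%:A : L).
Proof.
apply/seteqP; split.
  apply: ext_sub => [|_ [b /ringint_alg Ob <-]]; first exact: principal_module.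
  by exists b%:A => //; rewrite algM.
move=> _ [b Ob <-]; have [_ _ M] := ext_module (principal z); apply: M => //.
by apply: mem_ext; exists 1; [exact: ringint1|rewrite mul1r].
Qed.

Lemma gal_ext s a : s @` ext a = ext a.
Proof.
rewrite image_gal_idmul image_gal_ringint; congr idmul.
apply/seteqP; split=> [_ [_ [z az <-] <-]|_ [z az <-]].
  by exists z; rewrite // gal_alg.
by exists z%:A; [exists z|rewrite gal_alg].
Qed.

Lemma ext_integral p : integral_ideal p -> integral_ideal (ext p).
Proof.
case=> pO _ _ _ [z pz z0]; have [? ? ?] := ext_module p; split=> //.
  by apply: ext_sub => [|y /pO /ringint_alg //]; exact: ringint_is_module.
by exists z%:A; [exact: mem_ext|rewrite scaler_eq0 oner_eq0 orbF].
Qed.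

Lemma prime_lies_above p Q : prime_ideal p -> prime_ideal Q -> ext p `<=` Q ->
  contracted_ideal Q = p.
Proof.
move=> pp pQ pQsub; apply: (prime_sub_eq HF pp (contracted_prime pQ)) => z pz.
exact/pQsub/mem_ext.
Qed.

Section UnitsAway.
Variable S : set (set F).
Local Notation T := (@primes_above F L S).

Lemma primes_above_prime P : T P -> prime_ideal P.
Proof. by case=> p _ []. Qed.

Lemma idgen_invertible (t : set L) : idgen T t -> invertible t.
Proof.
elim=> [|P /primes_above_prime /(prime_invertible HL) //|I J _ iI _ iJ|I _ iI].
- exact: invertible_ringint.
- exact: invertibleM.
- exact: invertible_inv.
Qed.

(** This plays the part of the valuation at a prime outside [T]: a [T]-ideal is a
    quotient of two integral ideals of valuation zero. *)
Lemma idgen_fraction (t : set L) : idgen T t -> exists A B, [/\ integral_ideal A,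
  integral_ideal B, idmul t B = A &
  forall Q, prime_ideal Q -> ~ T Q -> ~ (A `<=` Q) /\ ~ (B `<=` Q)].
Proof.
have nO Q : prime_ideal Q -> ~ (ringint `<=` Q).
  by case=> _ nQ1 _ OQ; apply/nQ1/OQ/ringint1.
elim=> [|P TP|I J _ [A [B [iA iB AB H]]] _ [C [D [iC iD CD H']]]|I tI [A [B [iA iB AB H]]]].
- exists ringint, ringint; split; rewrite ?(idmul_ringint_r (@ringint_is_module L)) //.
  + exact: integral_ringint.
  + exact: integral_ringint.
  + by move=> Q /nO.
- have pP := primes_above_prime TP; exists P, ringint; split.
  + exact: prime_integral.
  + exact: integral_ringint.
  + exact/idmul_ringint_r/integral_module/prime_integral.
  + move=> Q pQ nTQ; split; last exact: nO.
    by move=> PQ; apply: nTQ; rewrite (prime_sub_eq HL pP pQ PQ).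
- exists (idmul A C), (idmul B D).
  split; [exact: integralM|exact: integralM|by rewrite idmulACA AB CD|].
  move=> Q pQ nTQ; have [[? ?] [? ?]] := (H Q pQ nTQ, H' Q pQ nTQ).
  by split=> /(prime_idmul_sub pQ) [].
- exists B, A; split=> //; last by move=> Q pQ nTQ; have [? ?] := H Q pQ nTQ.
  by rewrite -AB idmulK //; [exact: idgen_invertible|exact: integral_module].
Qed.

End UnitsAway.

(** An ideal of [L] that is invariant under the Galois group up to [T]-ideals comes
    from the base field up to [T]-ideals: at an unramified prime [p], invariance
    forces all the primes above [p] to divide it if one of them does, and then their
    product [pO_L] divides it. *)
Lemma invariant_ideal_descent (m : set F) :
  (forall p, prime_ideal p -> ~ iddvd p m -> unramified L p) ->
  forall I, integral_ideal I ->
    (forall s, exists2 t, idgen (@primes_above F L (modulus_support m)) t & s @` I = idmul I t) ->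
  exists a t, [/\ ray_ideals m a, idgen (@primes_above F L (modulus_support m)) t &
    I = idmul (ext a) t].
Proof.
move=> unr; set S := modulus_support m.
have inv t : idgen (@primes_above F L S) t -> invertible t by exact: idgen_invertible.
apply: (ideal_ind HL) => I iI IH sI; have mI := integral_module iI.
have [I1|nI1] := pselect (I 1).
  exists ringint, ringint; split; try exact: idgen_one.
  by rewrite ext_ringint (idmul_ringint_l (@ringint_is_module L)) (integral_eq_ringint iI I1).
(* A factor of [I] that is itself invariant up to [T]-ideals can be split off. *)
have remove E : integral_ideal E -> I `<=` E -> ~ E 1 ->
    (forall s, exists2 t, idgen (@primes_above F L S) t & s @` E = idmul E t) ->
    exists a t, [/\ ray_ideals m a, idgen (@primes_above F L S) t &
      I = idmul E (idmul (ext a) t)].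
  move=> iE IE nE1 sE; have invE := integral_invertible HL iE; have mE := integral_module iE.
  have [iJ EJ] := cofactor_integral invE iI IE; move: (idmul (idinv E) I) iJ EJ => J iJ EJ.
  have mJ := integral_module iJ.
  have [||s|a [t [ra tt JE]]] := IH J iJ.
  - by rewrite -EJ; apply: idmul_subr.
  - move=> JI; apply: nE1.
    have eIJ : J = I by apply/seteqP; split=> //; rewrite -EJ; apply: idmul_subr.
    rewrite (_ : E = ringint); first exact: ringint1.
    apply: (idmulI (integral_invertible HL iI) mE (@ringint_is_module L)).
    by rewrite idmul_ringint_r // idmulC -{1}eIJ EJ.
  - have [[t tt sIt] [u tu sEu]] := (sI s, sE s); exists (idmul t (idinv u)).
      by apply: idgen_mul => //; apply: idgen_inv.
    have msJ := image_gal_module s mJ; have [mt _] := inv t tt.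
    have e : idmul u (s @` J) = idmul J t.
      apply: (idmulI invE (idmul_module _ msJ) (idmul_module _ mt)).
      by rewrite !idmulA -sEu -image_gal_idmul EJ sIt.
    by rewrite idmulA -e idmulC idmulK //; apply: inv.
  - by exists a, t; split=> //; rewrite -JE.
have [P pP IP] := proper_sub_prime HL iI nI1; have iP := prime_integral pP.
have mP := integral_module iP; have [_ nP1 _] := pP.
have [TP|nTP] := pselect (@primes_above F L S P).
  have [|a [t [ra tt IE]]] := remove P iP IP nP1.
    move=> s; exists (idmul (idinv P) (s @` P)); last first.
      by rewrite idmulKV //; [exact: prime_invertible|exact: image_gal_module].
    by apply: idgen_mul; [apply/idgen_inv/idgen_in|apply/idgen_in/primes_above_gal].
  exists a, (idmul P t); split=> //; first by apply: idgen_mul => //; apply: idgen_in.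
  by rewrite IE idmulCA.
set p := contracted_ideal P : set F; have pp : prime_ideal p := contracted_prime pP.
have npm : ~ iddvd p m by move=> pm; apply: nTP; exists p.
have iE := ext_integral (prime_integral pp).
have EP : ext p `<=` P by exact: ext_sub.
have IE : I `<=` ext p.
  apply: (squarefree_divides HL iE iI) => Q pQ.
    move=> QQE; apply: (unr p pp npm Q _ QQE); split=> //.
    apply: prime_lies_above => //; have [C iC ->] := QQE; have iQ := prime_integral pQ.
    by rewrite -idmulA; apply: idmul_subl => //; apply: integralM.
  move=> EQ; have cQ := prime_lies_above pp pQ EQ.
  have [s Qs] := gal_transitive pP pQ (esym cQ).
  have nTQ : ~ @primes_above F L S Q.
    by case=> p' Sp' [_ cQ']; apply: nTP; exists p' => //; split=> //; rewrite -cQ' cQ.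
  (* [I A = (s I) B] lies in [Q], and [A] does not. *)
  have [t tt sIt] := sI s; have [A [B [iA iB tB nAB]]] := idgen_fraction tt.
  have [//|AQ] : I `<=` Q \/ A `<=` Q; last by have [] := nAB Q pQ nTQ.
  apply: prime_idmul_sub => //; rewrite -tB idmulA -sIt Qs.
  apply: subset_trans (_ : _ `<=` s @` I) _; last by apply: image_subset.
  by apply: idmul_subl => //; apply: image_gal_integral.
have [||a [t [ra tt IEat]]] := remove _ iE IE.
- by move=> /EP.
- move=> s; exists ringint; first exact: idgen_one.
  by rewrite gal_ext idmul_ringint_r //; apply: ext_module.
exists (idmul p a), t; split=> //; first by apply: idgen_mul => //; apply: idgen_in.
by rewrite extM -idmulA.
Qed.

End GaloisIdeals.

(** * Subquotients of finite abelian groups *)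

Section Duality.
Implicit Types (gT : finGroupType).
Local Open Scope group_scope.

Definition mult_char gT (G : {group gT}) (l : gT -> algC) : Prop :=
  {in G, forall x, l x != 0%R} /\ {in G &, forall x y, l (x * y) = (l x * l y)%R}.

Lemma mult_char1 gT (G : {group gT}) l : mult_char G l -> l 1 = 1%R.
Proof.
case=> l0 lM; have := lM 1 1 (group1 G) (group1 G); rewrite mulg1 => l11.
by apply: (mulfI (l0 1 (group1 G))); rewrite -l11 mulr1.
Qed.

Lemma sum_mult_char gT (G : {group gT}) l y : mult_char G l -> y \in G -> l y != 1%R ->
  (\sum_(x in G) l x = 0)%R.
Proof.
case=> l0 lM Gy ly; set S := (\sum_(x in G) _)%R.
have SE : (S = l y * S)%R.
  rewrite {1}/S (reindex_inj (mulgI y)) mulr_sumr.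
  by apply: eq_big => [x|x Gx]; rewrite ?groupMl // lM // -(groupMl _ Gy).
apply/eqP; apply: contraNT ly => S0.
by apply/eqP/(mulIf S0); rewrite mul1r -SE.
Qed.

(** A perfect symmetric pairing of [G] with itself, with values in the
    multiplicative group of a field with enough roots of unity; it identifies [G]
    with its group of characters. *)
Definition pairing gT (G : {group gT}) (b : gT -> gT -> algC) : Prop :=
  [/\ {in G, forall x, mult_char G (b x)},
      {in G &, forall x y, b x y = b y x} &
      {in G, forall x, (forall y, y \in G -> b x y = 1%R) -> x = 1}].

Lemma pairing_cycle gT (x : gT) : exists b, pairing <[x]> b.
Proof.
have [z pz] := C_prim_root_exists (order_gt0 x).
have z0 : z != 0%R.
  apply: contra_eq_neq (prim_expr_order pz) => ->.
  by rewrite expr0n gtn_eqF ?order_gt0 // eq_sym oner_neq0.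
have /choice[lg lgE] : forall a, exists i : nat, a \in <[x]> -> a = x ^+ i.
  by move=> a; case: (boolP (a \in <[x]>)) => [/cyclePmin[i _ ->]|_]; [exists i|exists 0%N].
have lgX i : lg (x ^+ i) = i %[mod #[x]].
  by apply/eqP; rewrite -eq_expg_mod_order -lgE ?mem_cycle.
pose b a c := (z ^+ (lg a * lg c))%R.
have bX i j : b (x ^+ i) (x ^+ j) = (z ^+ (i * j))%R.
  by apply/eqP; rewrite (eq_prim_root_expr pz) -modnMm !lgX modnMm.
exists b; split.
- move=> _ /cyclePmin[i _ ->]; split=> [_ /cyclePmin[j _ ->]|].
    by rewrite bX expf_neq0.
  by move=> _ _ /cyclePmin[j _ ->] /cyclePmin[k _ ->]; rewrite -expgD !bX mulnDr exprD.
- by move=> _ _ /cyclePmin[i _ ->] /cyclePmin[j _ ->]; rewrite !bX mulnC.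
- move=> _ /cyclePmin[i _ ->] /(_ x (cycle_id x)); rewrite -{2}[x]expg1 bX muln1.
  by move/eqP; rewrite -(prim_order_dvd pz) order_dvdn => /eqP.
Qed.

Lemma pairing_dprod gT (A B G : {group gT}) a b : A \x B = G ->
  pairing A a -> pairing B b -> exists c, pairing G c.
Proof.
move=> defG [aM aC a1] [bM bC b1]; have [_ defAB cAB _] := dprodP defG.
have memG u v : u \in A -> v \in B -> u * v \in G by move=> Au Bv; rewrite -defAB mem_mulg.
have /choice[p pE] : forall x, exists q : gT * gT, x \in G ->
    [/\ q.1 \in A, q.2 \in B, x = q.1 * q.2 &
      {in A & B, forall u t, x = u * t -> u = q.1 /\ t = q.2}].
  move=> x; case: (boolP (x \in G)) => [Gx|_]; last by exists (1, 1).
  by have [u [v H]] := mem_dprod defG Gx; exists (u, v).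
have decG x : x \in G -> exists u v, [/\ u \in A, v \in B & x = u * v].
  by move=> /pE [? ? ? _]; exists (p x).1, (p x).2.
pose c x y := (a (p x).1 (p y).1 * b (p x).2 (p y).2)%R.
have cE u v u' v' : u \in A -> v \in B -> u' \in A -> v' \in B ->
    c (u * v) (u' * v') = (a u u' * b v v')%R.
  move=> Au Bv Au' Bv'; rewrite /c.
  have [_ _ _ /(_ u v Au Bv erefl) [<- <-]] := pE _ (memG _ _ Au Bv).
  by have [_ _ _ /(_ u' v' Au' Bv' erefl) [<- <-]] := pE _ (memG _ _ Au' Bv').
have mulAB u v u' v' : v \in B -> u' \in A -> u * v * (u' * v') = (u * u') * (v * v').
  by move=> Bv Au'; rewrite -!mulgA; congr (_ * _); rewrite !mulgA (centsP cAB v Bv u' Au').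
exists c; split.
- move=> _ /decG[u [v [Au Bv ->]]]; have [a0 aD] := aM u Au; have [b0 bD] := bM v Bv.
  split=> [_ /decG[u' [v' [Au' Bv' ->]]]|].
    by rewrite cE // mulf_neq0 ?a0 ?b0.
  move=> _ _ /decG[u' [v' [Au' Bv' ->]]] /decG[w [t [Aw Bt ->]]].
  by rewrite mulAB // !cE ?groupM // aD // bD // mulrACA.
- move=> _ _ /decG[u [v [Au Bv ->]]] /decG[u' [v' [Au' Bv' ->]]].
  by rewrite !cE // aC // bC.
- move=> _ /decG[u [v [Au Bv ->]]] c1.
  have u1 : u = 1.
    apply: a1 => // y Ay; have := c1 (y * 1) (memG _ _ Ay (group1 B)).
    by rewrite cE // (mult_char1 (bM v Bv)) mulr1.
  have v1 : v = 1.
    apply: b1 => // y By; have := c1 (1 * y) (memG _ _ (group1 A) By).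
    by rewrite cE // (mult_char1 (aM u Au)) mul1r.
  by rewrite u1 v1 mulg1.
Qed.

Lemma pairing_exists gT (G : {group gT}) : abelian G -> exists b, pairing G b.
Proof.
move=> /abelian_structure [s [defG _]]; elim: s G defG => [|x s IH] G.
  rewrite big_nil => defG; exists (fun _ _ => 1%R).
  split=> [x _|//|x]; first by split=> *; rewrite ?oner_neq0 ?mulr1.
  by rewrite -defG inE => /eqP.
rewrite big_cons => defG; have [[U V _ defV] _ _ _] := dprodP defG.
rewrite defV in defG; have [b pb] := IH V defV; have [a pa] := pairing_cycle x.
exact: pairing_dprod defG pa pb.
Qed.

(** Otherwise [l] would be orthogonal to all the restrictions of [b x], contrary
    to the fact that these sum to a multiple of the indicator function of 1. *)
Lemma pairing_extends gT (G H : {group gT}) b l : pairing G b -> H \subset G ->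
  mult_char H l -> exists2 x, x \in G & forall y, y \in H -> b x y = l y.
Proof.
move=> [bM bC b1] sHG [l0 lM]; apply: contrapT => nex.
have b0 x y : x \in G -> y \in G -> b x y != 0%R by move=> Gx Gy; have [-> //] := bM x Gx.
have HG y : y \in H -> y \in G by apply: (fintype.subsetP sHG).
have bD x : x \in G -> mult_char H (fun y => (l y * (b x y)^-1)%R).
  move=> Gx; have [bx0 bxM] := bM x Gx; split=> [y Hy|y z Hy Hz].
    by rewrite mulf_neq0 ?l0 // invr_eq0 bx0 ?HG.
  by rewrite lM // bxM ?HG // invfM mulrACA.
have S0 : (\sum_(x in G) \sum_(y in H) l y * (b x y)^-1 = 0)%R.
  apply: big1 => x Gx.
  have [y Hy ly] : exists2 y, y \in H & (l y * (b x y)^-1)%R != 1%R.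
    apply: contra_notP nex => nexy; exists x => // y Hy; apply/eqP.
    apply: contraT => nb; case: nexy; exists y => //.
    have Gy := HG y Hy.
    apply: contraNneq nb => lb; rewrite -[l y](mulfVK (b0 x y Gx Gy)).
    by rewrite [(_ / _)%R]lb mul1r.
  exact: (sum_mult_char (bD x Gx) Hy ly).
move: S0; rewrite exchange_big (bigD1 1) //= [X in (_ + X)%R]big1 ?addr0; last first.
  move=> y /andP[Hy y1]; have Gy := HG y Hy.
  rewrite -mulr_sumr; apply/eqP; rewrite mulf_eq0; apply/orP; right; apply/eqP.
  have [x Gx bx] : exists2 x, x \in G & b x y != 1%R.
    apply: contra_notP (elimN eqP y1) => nexx; apply: (b1 y Gy) => x Gx.
    by rewrite bC //; apply/eqP; apply: contraT => bx; case: nexx; exists x.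
  apply: (@sum_mult_char _ G (fun x => (b x y)^-1)%R x) => //; last by rewrite invr_eq1.
  have [by0 byM] := bM y Gy; split=> [w Gw|w t Gw Gt]; first by rewrite invr_eq0 b0.
  by rewrite bC ?groupM // byM // invfM bC // [b y t]bC.
have -> : (\sum_(x in G) l 1%g / b x 1%g = #|G|%:R)%R.
  rewrite -[RHS]mulr1 mulr_natl -sumr_const; apply: eq_bigr => x Gx.
  by rewrite (mult_char1 (conj l0 lM)) (mult_char1 (bM x Gx)) divr1.
by move/eqP; rewrite pnatr_eq0 (gtn_eqF (cardG_gt0 G)).
Qed.

(** Restricting characters from [G] to [H] is onto, and pairings identify both
    groups with their character groups. *)
Lemma abelian_onto_subgroup gT (G H : {group gT}) : abelian G -> H \subset G ->
  exists f : gT -> gT, [/\ {in G &, forall x y, f (x * y) = f x * f y},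
    {in G, forall x, f x \in H} & {in H, forall h, exists2 x, x \in G & f x = h}].
Proof.
move=> cG sHG; have HG y : y \in H -> y \in G by apply: (fintype.subsetP sHG).
have [b pb] := pairing_exists cG; have [c pc] := pairing_exists (abelianS sHG cG).
have [[bM bC b1] [cM cC c1]] := (pb, pc).
have bH x : x \in G -> mult_char H (b x).
  by move=> /bM[b0 bD]; split=> [y Hy|y z Hy Hz]; rewrite ?bD ?b0 ?HG.
have /choice[f fE] : forall x, exists h, x \in G ->
    h \in H /\ forall y, y \in H -> c h y = b x y.
  move=> x; case: (boolP (x \in G)) => [Gx|_]; last by exists 1.
  by have [h Hh E] := pairing_extends pc (subxx H) (bH x Gx); exists h.
have cinj h h' : h \in H -> h' \in H -> (forall y, y \in H -> c h y = c h' y) -> h = h'.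
  move=> Hh Hh' E; apply: (mulIg h'^-1); rewrite mulgV.
  apply: c1; first by rewrite groupM ?groupV.
  move=> y Hy; have [cy0 cyM] := cM y Hy.
  rewrite cC ?groupM ?groupV // cyM ?groupV // cC // E // cC // -cyM ?groupV // mulgV.
  exact: mult_char1 (cM y Hy).
exists f; split.
- move=> x y Gx Gy; have [Hx cx] := fE x Gx; have [Hy cy] := fE y Gy.
  have [Hxy cxy] := fE (x * y) (groupM Gx Gy).
  apply: cinj; rewrite ?groupM // => z Hz; rewrite cxy // cC ?groupM //.
  have [_ ->] := cM z Hz => //; rewrite ![c z _]cC // cx // cy //.
  have Gz := HG z Hz.
  by rewrite bC ?groupM //; have [_ ->] := bM z Gz => //; rewrite ![b z _]bC.
- by move=> x /fE[].
- move=> h Hh; have [x Gx E] := pairing_extends pb sHG (cM h Hh).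
  by exists x => //; have [Hx cx] := fE x Gx; apply: cinj => // y Hy; rewrite cx // E.
Qed.

Lemma abelian_onto_subquotient gT (G : {group gT}) (M : zmodType) (R : gT -> M -> Prop) :
  abelian G -> (forall x c, R x c -> x \in G) ->
  (forall x c d, R x c -> R x d -> c = d) ->
  (forall x y c d, R x c -> R y d -> R (x * y) (c + d)%R) ->
  (forall c, exists x, R x c) ->
  exists f : gT -> M, {in G &, forall x y, f (x * y) = (f x + f y)%R} /\
    forall c, exists2 x, x \in G & f x = c.
Proof.
move=> cG RG Rfun RM Ronto.
pose H := [set x | `[< exists c, R x c >]].
have HP x : reflect (exists c, R x c) (x \in H) by rewrite inE; apply: asboolP.
(* If [x] is related to 0, so are all its positive powers, and 1 is one of them. *)
have R1 : R 1 0%R.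
  have [x Rx] := Ronto 0%R; rewrite -(expg_order x); have := order_gt0 x.
  case: #[x] => // n _; elim: n => // n IH.
  by rewrite expgS -(addr0 0%R); apply: RM.
have gH : group_set H.
  apply/group_setP; split; first by apply/HP; exists 0%R.
  by move=> x y /HP[c Rc] /HP[d Rd]; apply/HP; exists (c + d)%R; apply: RM.
have /choice[r rE] : forall x, exists c, x \in H -> R x c.
  by move=> x; case: (HP x) => [[c Rc]|_]; [exists c|exists 0%R].
have sHG : Group gH \subset G by apply/fintype.subsetP => x /HP[c /RG].
have [f [fM fH fonto]] := abelian_onto_subgroup cG sHG.
exists (r \o f); split=> [x y Gx Gy|c] /=.
  by apply: (Rfun (f (x * y))); [apply/rE/fH/groupM|rewrite fM //; apply: RM; apply/rE/fH].
have [x Rx] := Ronto c; have Hx : x \in H by apply/HP; exists c.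
have [y Gy fy] := fonto x Hx; exists y => //=; rewrite fy.
by apply: Rfun Rx; apply: rE.
Qed.

End Duality.

(** * The class of a cocycle of units *)

Lemma int_neq0 (K : fieldType) (HK : number_field K) (c : int) : c != 0 -> c%:~R != 0 :> K.
Proof.
by case: c => [[|n]|n] // _; rewrite ?NegzE ?mulrNz ?oppr_eq0 -pmulrn natr_neq0.
Qed.

(** If [x] is a root of an integer polynomial with leading coefficient [c], then
    [c x] is a root of a monic one. *)
Lemma ringint_scale (K : fieldType) (HK : number_field K) (x : K) :
  exists2 n, (0 < n)%N & ringint (n%:R * x).
Proof.
have [_ [d rank_d]] := HK; have [b [[i id bi] Sb]] := rank_d (fun k => x ^+ k).
pose p := \poly_(k < d.+1) b k.
have p0 : p != 0.
  by apply: contraNneq bi => p0; have := coef_poly d.+1 b i; rewrite -/p p0 coef0 id => <-.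
have px : (map_poly intr p).[x] = 0.
  rewrite -[RHS]Sb; rewrite (@horner_coef_wide _ d.+1); last first.
    by apply: leq_trans (size_poly _ _) _; apply: size_poly.
  by apply: eq_bigr => k _; rewrite coef_map /= coef_poly ltn_ord.
move: p p0 px => {b i id bi Sb} p p0 px; pose c := lead_coef p.
have c0 : c != 0 by rewrite lead_coef_eq0.
suff Ocx : ringint (c%:~R * x).
  move: c c0 Ocx => [] n n0 On; first by exists n; rewrite ?lt0n // pmulrn.
  by exists n.+1 => //; move: (ringintN On); rewrite NegzE mulrNz mulNr opprK pmulrn.
have sp : size p = (size p).-1.+1 by rewrite prednK // size_poly_gt0.
have pxE : \sum_(k < size p) (p`_k)%:~R * x ^+ k = 0.
  rewrite -[RHS]px (@horner_coef_wide _ (size p)) ?size_poly //.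
  by apply: eq_bigr => k _; rewrite coef_map.
have lcE : c = p`_(size p).-1 by [].
move: pxE; rewrite sp; move: (size p).-1 lcE => e lcE; rewrite big_ord_recr /= -lcE.
case: e lcE => [|e] lcE.
  by rewrite big_ord0 add0r mulr1 => /eqP; rewrite (negPf (int_neq0 HK c0)).
move=> pxE; pose q : {poly K} := \poly_(k < e.+1) (p`_k * c ^+ (e - k))%:~R.
have mq : 'X^(e.+1) + q \is monic.
  by rewrite monicE lead_coefDl ?lead_coefXn // size_polyXn ltnS size_poly.
apply: (integral_root_monic mq).
  rewrite /root hornerD hornerXn horner_poly; apply/eqP.
  transitivity (c%:~R ^+ e * 0 : K); last by rewrite mulr0.
  rewrite -[in RHS]pxE mulrDr addrC; congr (_ + _); last by rewrite exprMn exprSr -mulrA.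
  rewrite mulr_sumr; apply: eq_bigr => k _; have ke : (k <= e)%N by rewrite -ltnS.
  have -> : c%:~R ^+ e = c%:~R ^+ (e - k) * c%:~R ^+ k :> K by rewrite -exprD subnK.
  by rewrite intrM rmorphXn /= exprMn [RHS]mulrCA -!mulrA.
apply/integral_poly => k; rewrite !coefE; apply: ringintD; first exact: ringint_nat.
by case: ifP => _; [exact: ringint_int|exact: ringint0].
Qed.

Section CohomologyClasses.
Variables (gT : finGroupType) (M : zmodType) (to : gmodule gT M).

(** The ascription exposes the quotient structure that [H1] hides. *)
Definition h1_class (z : Z1 to) : H1 to := \pi_(Quotient.quot (@B1 _ _ to))%qT z.

Lemma cocycleD (z w : Z1 to) g : (z + w) g = z g + w g.
Proof. by rewrite ffunE. Qed.

Lemma cocycleB (z w : Z1 to) g : (z - w) g = z g - w g.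
Proof. by rewrite !ffunE. Qed.

Lemma h1_classD z w : h1_class (z + w) = h1_class z + h1_class w.
Proof. exact: Quotient.pi_add. Qed.

Lemma h1_class_eq z w : z - w \in @B1 _ _ to -> h1_class z = h1_class w.
Proof. by rewrite Quotient.idealrBE => /eqP. Qed.

Lemma h1_class_onto c : exists z, h1_class z = c.
Proof. by exists (generic_quotient.repr (c : Quotient.quot (@B1 _ _ to))); apply: reprK. Qed.

End CohomologyClasses.

Section Cocycles.
Variables (F : fieldExtType rat) (L : splittingFieldType F) (m : set F).
Hypothesis ray : ray_class_field L m.
Local Open Scope classical_set_scope.
Implicit Types (s t : gal_of {:L}) (a : set F).

Local Notation S := (modulus_support m).
Local Notation T := (@primes_above F L S).
Local Notation ext := (@extended_ideal F L).
Local Notation M := (sunit_gmodule L S).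

Let HL : number_field L := number_field_ext L.
Let HF : number_field F := number_field_rat F.
Let galL : galois 1 {:L}. Proof. by case: ray. Qed.

(** The class of [s |-> s x / x] in [H1]. *)
Definition principal_class (x : L) (c : H1 M) : Prop :=
  exists z : Z1 M, h1_class z = c /\ forall s, s x = val (z s) * x.

Lemma principal_classM x y c d :
  principal_class x c -> principal_class y d -> principal_class (x * y) (c + d).
Proof.
case=> z [<- zx] [w [<- wy]]; exists (z + w); split; first by rewrite h1_classD.
move=> s; rewrite -[s _]/(s (x * y)); have -> : s (x * y) = s x * s y by exact: rmorphM.
by rewrite zx wy cocycleD mulrACA.
Qed.

(** As [w] is fixed by the Galois group, the two cocycles differ by the coboundary
    of the [T]-unit [x / (y w)]. *)
Lemma principal_class_unit x y (w : F) c d : x != 0 -> y != 0 -> w != 0 ->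
  principal_class x c -> principal_class y d ->
  idgen T (principal (x / (y * w%:A))) -> c = d.
Proof.
move=> x0 y0 w0 [z [<- zx]] [v [<- vy]] Tu; set u := x / _ in Tu.
have w0' : w%:A != 0 :> L by rewrite scaler_eq0 oner_eq0 orbF.
have u0 : u != 0 by rewrite mulf_neq0 ?invr_eq0 ?mulf_neq0.
have uU : u \in sunit_pred T by rewrite inE u0; apply/asboolP.
apply: h1_class_eq; apply/asboolP; exists (SUnit uU) => s.
rewrite cocycleB; apply: val_inj => /=.
have su : s u = s x / (s y * s w%:A).
  by rewrite /u fmorph_div; congr (_ / _); apply: rmorphM.
have v0 : val (v s) != 0 by have [] := sunitP (v s).
by apply: (mulIf u0); rewrite divfK // su zx vy gal_alg /u mulf_div mulrA.
Qed.

Lemma principal_class_exists (c : H1 M) : exists x, [/\ x != 0, ringint x & principal_class x c].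
Proof.
have [z <-] := h1_class_onto c; have zM s t : z (s * t)%g = sunit_gal (z s) t + z t.
  by have /asboolP := valP z; apply.
have z0 s : val (z s) != 0 by have [] := sunitP (z s).
have [s t|x x0 xE] := hilbert90 z0; first by rewrite zM.
have [n n0 On] := ringint_scale HL x.
exists (n%:R * x); split=> //; first by rewrite mulf_neq0 ?(natr_neq0 HL).
exists z; split=> // s; have -> : s (n%:R * x) = s n%:R * s x by exact: rmorphM.
have -> : s n%:R = n%:R by exact: rmorph_nat.
by rewrite xE mulrCA.
Qed.


Let genT (I : set L) : idgen T I -> invertible I := @idgen_invertible _ _ _ _.

Lemma ray_ideal_invertible a : ray_ideals m a -> invertible a.
Proof.
elim=> [|p [pp _]|I J _ iI _ iJ|I _ iI].
- exact: invertible_ringint.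
- exact: (prime_invertible HF).
- exact: invertibleM.
- exact: invertible_inv.
Qed.

Lemma ray_principalP a : ray_principal m a -> exists2 w, w != 0 & a = principal w.
Proof.
elim=> [|_ [w [w0 _ _ _ ->]]|_ _ _ [w w0 ->] _ [v v0 ->]|_ _ [w w0 ->]].
- by exists 1; rewrite ?oner_neq0 ?principal1.
- by exists w.
- by exists (w * v); rewrite ?mulf_neq0 ?principalM.
- by exists w^-1; rewrite ?invr_eq0 ?principalV.
Qed.

(** The correspondence between the subgroup of [G] formed by the images of the ideals
    that become principal in [L] up to [T]-ideals, and the cohomology classes defined
    by generators of these principal ideals. *)
Definition capitulation (psi : set F -> gal_of {:L}) (k : gal_of {:L}) (c : H1 M) : Prop :=
  exists a x (t : set L), [/\ ray_ideals m a, psi a = k, x != 0 & principal_class x c] /\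
    (idgen T t /\ principal x = idmul (ext a) t).

Section Reciprocity.
Variable psi : set F -> gal_of {:L}.
Hypothesis psiM : forall I J, ray_ideals m I -> ray_ideals m J ->
  psi (idmul I J) = (psi I * psi J)%g.
Hypothesis psi_ker : forall I, ray_ideals m I -> (psi I = 1%g <-> ray_principal m I).

(** The kernel of the reciprocity map consists of principal ideals. *)
Lemma same_image a b : ray_ideals m a -> ray_ideals m b -> psi a = psi b ->
  exists2 w, w != 0 & a = idmul b (principal w).
Proof.
move=> ra rb eab; have [ib ia] := (ray_ideal_invertible rb, ray_ideal_invertible ra).
have rV : ray_ideals m (idinv b) by apply: idgen_inv.
have psi1 : psi ringint = 1%g by apply/psi_ker; apply: idgen_one.
have /ray_principalP[w w0 wE] : ray_principal m (idmul (idinv b) a).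
  apply/psi_ker; first exact: idgen_mul.
  by rewrite psiM // eab -psiM // idmulC; have [_ ->] := ib.
by exists w => //; rewrite -wE idmulKV //; case: ia.
Qed.

(** Two generators of the same ideal up to [T]-ideals and elements of [F] differ by
    a [T]-unit and an element of [F]. *)
Lemma capitulation_fun k c d : capitulation psi k c -> capitulation psi k d -> c = d.
Proof.
case=> a [x [t [[ra psia x0 xc] [tt xE]]]] [b [y [u [[rb psib y0 yd] [tu yE]]]]].
have [w w0 aE] := same_image ra rb (etrans psia (esym psib)).
have w0' : w%:A != 0 :> L by rewrite scaler_eq0 oner_eq0 orbF.
have yw0 : y * w%:A != 0 by rewrite mulf_neq0.
apply: (principal_class_unit x0 y0 w0 xc yd); set v := x / _.
have [it iu] := (genT tt, genT tu).
have vE : idmul (principal v) u = t.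
  apply: (idmulI (principal_invertible yw0) (idmul_module _ iu.1) it.1).
  rewrite idmulA -principalM [_ * v]mulrC divfK // xE aE extM ext_principal.
  rewrite principalM yE; move: (ext b) (principal w%:A) => eb pw.
  by rewrite -!idmulA; congr idmul; rewrite [RHS]idmulCA (idmulC t).
have -> : principal v = idmul t (idinv u).
  by rewrite -vE [RHS]idmulC (idmulC (principal v)) idmulK //; apply: principal_module.
by apply: idgen_mul => //; apply: idgen_inv.
Qed.

Lemma capitulationM k l c d : capitulation psi k c -> capitulation psi l d ->
  capitulation psi (k * l)%g (c + d).
Proof.
case=> a [x [t [[ra <- x0 xc] [tt xE]]]] [b [y [u [[rb <- y0 yd] [tu yE]]]]].
exists (idmul a b), (x * y), (idmul t u); split.
  by split; [exact: idgen_mul|rewrite psiM|rewrite mulf_neq0|exact: principal_classM].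
by split; [exact: idgen_mul|rewrite principalM xE yE idmulACA extM].
Qed.

(** The generator given by Hilbert 90 spans an ideal to which descent applies. *)
Lemma capitulation_onto c : exists k, capitulation psi k c.
Proof.
have [x [x0 Ox xc]] := principal_class_exists c.
have [_ _ unr _] := ray.
have [s|a [t [ra tt xE]]] := invariant_ideal_descent galL unr (principal_integral Ox x0).
  have [z [_ zx]] := xc; exists (principal (val (z s))); first by have [] := sunitP (z s).
  by rewrite image_gal_principal zx mulrC principalM.
by exists (psi a), a, x, t.
Qed.

End Reciprocity.

End Cocycles.

Theorem theorem2p16 (F : fieldExtType rat) (m : set F)
    (Hm : integral_ideal m)
    (L : splittingFieldType F) (HL : ray_class_field L m) :
  exists f : gal_of {:L} -> H1 (sunit_gmodule L (modulus_support m)),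
    {morph f : s t / (s * t)%g >-> s + t} /\ forall c, exists s, f s = c.
Proof.
have [galL cG _ [psi [[psiM _] _ psi_ker]]] := HL.
have [f [fM fonto]] := abelian_onto_subquotient cG (fun k (_ : H1 _) _ => mem_gal1 k)
  (@capitulation_fun _ _ _ _ psiM psi_ker) (@capitulationM _ _ _ _ psiM)
  (capitulation_onto HL psi).
exists f; split=> [s t|c]; first by apply: fM; apply: mem_gal1.
by have [s _ fs] := fonto c; exists s.
Qed.
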